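(* Consider any tenable balanced $2\times2$ urn with subtraction, with matrix $\begin{pmatrix}-a&a+s\\ b+s&-b\end{pmatrix}$ and $h:=a+b+s$, and let $X_n$ be the number of balls of the first color at time $n$. Let $\xi$ be any number of the open interval $\left(0,\,s\frac{s+b}{s+h}\right)$. One has $$\lim_{n\to\infty}\frac1n\log\mathbb{P}(X_n\le\xi\cdot n)=-\mathcal{R}(\xi),$$ where the rate function $\mathcal{R}$ is determined by $$\mathcal{R}(\xi)=\max_{\lambda\in(0,1)}\log\bigl(s\lambda^\xi K(\lambda)\bigr),\qquad K(u):=\frac1{\delta(u)^s}\int_u^1\frac{t^{a-1}}{\delta(t)^{a+b}}\,dt,\qquad \delta(u):=(1-u^h)^{1/h}.$$ Equivalently, $$\mathcal{R}(\xi)=\log\bigl(s\lambda_0^\xi K(\lambda_0)\bigr)\qquad\text{where }\lambda_0\in(0,1)\text{ satisfies }\frac{\lambda_0K'(\lambda_0)}{K(\lambda_0)}+\xi=0.$$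
   Context: Here $a,b,s$ are positive integers and the urn starts with $a_0$ balls of the first color and $b_0$ of the second, $a_0+b_0\ge1$. At each time step a ball is drawn uniformly at random, observed and put back; if it is of the first color, $a$ balls of the first color are removed and $a+s$ of the second are added; if it is of the second color, $b+s$ balls of the first color are added and $b$ of the second are removed. Tenability: $a\mid a_0$, $b\mid b_0$, $a\mid b+s$, $b\mid a+s$. *)

(* Defs.v *)
From HB Require Import structures.
From mathcomp Require Import all_boot all_order all_algebra.
From mathcomp Require Import all_classical all_reals all_analysis.

Set Implicit Arguments.
Unset Strict Implicit.
Unset Printing Implicit Defensive.

Import Order.TTheory GRing.Theory Num.Theory.
Import numFieldNormedType.Exports.

Local Open Scope classical_set_scope.
Local Open Scope ring_scope.

(* [c i] is the color of the ball drawn at step i + 1, [true] standing for the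
   first color.  The counts are integers so that no removal is ever truncated:
   they are nonnegative along every color sequence of positive probability, but
   drawing a color that is absent from the urn makes them negative. *)
Fixpoint urn_state (a b s a0 b0 : nat) (c : nat -> bool) (n : nat) : int * int :=
  if n is m.+1 then
    let: (x, y) := urn_state a b s a0 b0 c m in
    if c m then (x - a%:Z, y + (a + s)%N%:Z)
    else (x + (b + s)%N%:Z, y - b%:Z)
  else (a0%:Z, b0%:Z).

Definition first_count (a b s a0 b0 : nat) (c : nat -> bool) (n : nat) : int :=
  (urn_state a b s a0 b0 c n).1.

Definition second_count (a b s a0 b0 : nat) (c : nat -> bool) (n : nat) : int :=
  (urn_state a b s a0 b0 c n).2.

(* The process of successively drawn colors: given the colors [c 0], ...,
   [c n.-1] of the first n draws, the next ball is of the first color with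
   conditional probability x / (x + y), where (x, y) is the composition that
   these draws produce.  The identity is written multiplied out by the
   probability of the conditioning event, so that null histories impose
   nothing. *)
Definition urn_draws (R : realType) (d : measure_display)
    (T : measurableType d) (P : probability T R) (a b s a0 b0 : nat)
    (D : nat -> T -> bool) : Prop :=
  (forall n, measurable_fun setT (D n)) /\
  (forall (n : nat) (c : nat -> bool),
    let past := [set w | forall i, (i < n)%N -> D i w = c i] in
    let x : R := (first_count a b s a0 b0 c n)%:~R in
    let y : R := (second_count a b s a0 b0 c n)%:~R in
    (P (past `&` [set w | D n w = true]) = (x / (x + y))%:E * P past)%E).

Definition urn_X (T : Type) (a b s a0 b0 : nat) (D : nat -> T -> bool)
    (n : nat) (w : T) : int :=
  first_count a b s a0 b0 (fun i => D i w) n.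

Definition urn_h (a b s : nat) : nat := (a + b + s)%N.

Definition urn_delta (R : realType) (a b s : nat) (u : R) : R :=
  (1 - u ^+ urn_h a b s) `^ (urn_h a b s)%:R^-1.

(* The integrand is unbounded near t = 1 but integrable, as (a + b) / h < 1. *)
Definition urn_K (R : realType) (a b s : nat) (u : R) : R :=
  (urn_delta a b s u ^+ s)^-1 *
  \int[lebesgue_measure]_(t in `]u, 1[%classic)
     (t ^+ (a - 1) / urn_delta a b s t ^+ (a + b)).

Definition rate_objective (R : realType) (a b s : nat) (xi lambda : R) : R :=
  ln (s%:R * lambda `^ xi * urn_K a b s lambda).

(* A supremum; that it is a maximum is part of the theorem. *)
Definition rate_function (R : realType) (a b s : nat) (xi : R) : R :=
  sup [set rate_objective a b s xi lambda | lambda in `]0, 1[].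

Definition critical_point (R : realType) (a b s : nat) (xi lambda : R) : Prop :=
  [/\ 0 < lambda < 1,
      derivable (@urn_K R a b s) lambda 1 &
      lambda * derive1 (@urn_K R a b s) lambda / urn_K a b s lambda + xi = 0].

(* Main.v *)
Require Import Defs.
From HB Require Import structures.
From mathcomp Require Import all_boot all_order all_algebra.
From mathcomp Require Import all_classical all_reals all_analysis.
From mathcomp Require Import measurable_realfun.
From mathcomp Require Import ring lra zify.
Import Order.TTheory GRing.Theory Num.Theory.
Import numFieldNormedType.Exports.
Local Open Scope classical_set_scope.
Local Open Scope ring_scope.

Set Implicit Arguments.
Unset Strict Implicit.
Unset Printing Implicit Defensive.

(** Count the balls in bunches of [a] balls of the first color and [b] of the
    second: by tenability a draw turns one bunch of the first color into [q]
    bunches of the second, or one of the second into [p] of the first.  Weighting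
    each draw by the number of balls of the drawn color, P(X_n in A) is the weight
    of the n-step histories that end in A divided by the product of the totals
    a0 + b0 + s l, l < n, which is s^n n! up to a polynomial factor ([urn_law],
    [rising_lower], [rising_upper]).

    The weight of histories is the n-th derivative of X^i Y^j along the flow
    X' = a Y^q, Y' = b X^p.  On the level set of this flow that matters the
    solution is X = (u / delta u)^a, Y = (delta u)^-b, with the clock tau that
    satisfies dtau = u^(a-1) / delta(u)^(a+b) du ([hist_orbit_derive]); the
    remaining time before blow-up is the integral in the definition of K.  All
    derivatives being nonnegative, the functions X^i Y^j are absolutely monotone
    in tau.  Their Taylor coefficients at u are thus at most of the exponential
    order (remaining time)^-n ([taylor_coeff_le]), and they reach this order
    infinitely often, since otherwise the solution would stay bounded
    ([absolutely_monotone_bounded]).  Histories of an urn split into two independent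
    sub-urns, so that the coefficients are supermultiplicative up to a polynomial
    loss, and the lower bound holds for every n ([supermultiplicative_lower]).
    Together, E(u^X_n) behaves like (s K(u))^-n for every u in (0, 1)
    ([hist_growth_upper], [hist_growth_lower]).

    The function u^xi K(u) has a derivative of the sign of an explicit function,
    the gap, which changes sign exactly once on (0, 1), from plus to minus
    ([critical_gap_root]).  Hence there is one critical point lambda0, and it is
    the unique maximum.  Markov's inequality at lambda0 gives the upper bound of
    the deviation probability ([below_count_upper]).  For the lower bound take
    xi2 < xi, whose optimal parameter is smaller, and tilt by a parameter u between
    the two optima: with respect to the tilted weights u^X, both X_n > xi n and
    X_n < xi2 n are exponentially negligible, just because moving the parameter to
    the right increases u^xi K(u) and moving it to the left increases u^xi2 K(u)
    ([below_count_lower]).  On the remaining window u^X_n is at most u^(xi2 n), which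
    bounds P(X_n <= xi n) from below by (s u^xi2 K(u))^-n up to a subexponential
    factor, and xi2 can be taken arbitrarily close to xi ([deviation_window]). *)

(** * Derivatives of real functions *)

Section DerivativeSign.
Variables (R : realType) (f df : R -> R) (u v : R).
Hypothesis f_derive : forall x, u <= x <= v -> is_derive x 1 f (df x).

Lemma is_derive_mvt : u < v -> exists2 c, u < c < v & f v - f u = df c * (v - u).
Proof.
move=> uv; have [||c] := @MVT R f df u v uv.
- by move=> x; rewrite in_itv/= => /andP[ux xv]; apply: f_derive; rewrite !ltW.
- apply: continuous_in_subspaceT => x; rewrite inE/= in_itv/= => /f_derive xf.
  by apply: differentiable_continuous; apply/derivable1_diffP; apply: ex_derive.
- by rewrite in_itv => cuv; exists c.
Qed.

Lemma is_derive_ge0_le : u <= v -> (forall x, u < x < v -> 0 <= df x) -> f u <= f v.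
Proof.
rewrite le_eqVlt => /predU1P[->//|uv] df0.
have [c cuv fE] := is_derive_mvt uv.
by rewrite -subr_ge0 fE mulr_ge0 ?df0 // subr_ge0 ltW.
Qed.

Lemma is_derive_gt0_lt : u < v -> (forall x, u < x < v -> 0 < df x) -> f u < f v.
Proof.
move=> uv df0; have [c cuv fE] := is_derive_mvt uv.
by rewrite -subr_gt0 fE mulr_gt0 ?df0 // subr_gt0.
Qed.

Lemma is_derive_lt0_gt : u < v -> (forall x, u < x < v -> df x < 0) -> f v < f u.
Proof.
move=> uv df0; have [c cuv fE] := is_derive_mvt uv.
by rewrite -subr_lt0 fE nmulr_rlt0 ?df0 // subr_gt0.
Qed.

End DerivativeSign.

(** The differentiation rules in pointwise form: a derivative is computed by applying
    them to one another along the shape of the expression. *)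
Section PointwiseDerivatives.
Variables (R : realType) (x : R).
Implicit Types f g : R -> R.

Lemma derD f g df dg : is_derive x 1 f df -> is_derive x 1 g dg ->
  is_derive x 1 (fun y => f y + g y) (df + dg).
Proof. by move=> fx gx; apply: is_deriveD. Qed.

Lemma derN f df : is_derive x 1 f df -> is_derive x 1 (fun y => - f y) (- df).
Proof. by move=> fx; apply: is_deriveN. Qed.

Lemma derB f g df dg : is_derive x 1 f df -> is_derive x 1 g dg ->
  is_derive x 1 (fun y => f y - g y) (df - dg).
Proof. by move=> fx gx; apply: is_deriveB. Qed.

Lemma derC (c : R) : is_derive x 1 (fun=> c) 0.
Proof. exact: is_derive_cst. Qed.

Lemma derM f g df dg : is_derive x 1 f df -> is_derive x 1 g dg ->
  is_derive x 1 (fun y => f y * g y) (df * g x + f x * dg).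
Proof.
move=> fx gx; rewrite addrC [df * _]mulrC.
exact: (@is_deriveM R R f g x 1 df dg).
Qed.

Lemma derCM c f df : is_derive x 1 f df -> is_derive x 1 (fun y => c * f y) (c * df).
Proof. by move=> fx; apply: is_derive_eq (derM (derC c) fx) _; rewrite mul0r add0r. Qed.

Lemma derX f df n : is_derive x 1 f df ->
  is_derive x 1 (fun y => f y ^+ n) (n%:R * f x ^+ n.-1 * df).
Proof.
move=> fx; elim: n => [|n IHn] /=; first by rewrite !mul0r; exact: derC.
have := derM fx IHn.
under [X in is_derive _ _ X _]eq_fun do rewrite -exprS.
move=> /is_derive_eq; apply; case: n {IHn} => [|n] /=; first by rewrite expr0; ring.
by rewrite exprS -[n.+2%:R]natr1; ring.
Qed.

Lemma derV f df : f x != 0 -> is_derive x 1 f df ->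
  is_derive x 1 (fun y => (f y)^-1) (- df / f x ^+ 2).
Proof.
move=> fx0 fx; apply: DeriveDef; first exact: derivableV fx0 (@ex_derive _ _ _ _ _ _ _ fx).
by rewrite deriveV // derive_val /GRing.scale /= mulrC mulNr mulrN.
Qed.

End PointwiseDerivatives.

(** * Absolutely monotone families *)

(** The functions [g n] are the successive derivatives of [g 0] with respect to the
    clock [Z], whose speed is [w]; working with the parameter itself spares the
    inversion of the clock. *)
Section AbsolutelyMonotone.
Variables (R : realType) (u : R) (w Z : R -> R) (g : nat -> R -> R).
Hypothesis w_gt0 : forall x, u <= x < 1 -> 0 < w x.
Hypothesis Z_derive : forall x, u <= x < 1 -> is_derive x 1 Z (w x).
Hypothesis Z_u : Z u = 0.
Hypothesis g_ge0 : forall n x, u <= x < 1 -> 0 <= g n x.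
Hypothesis g_derive : forall n x, u <= x < 1 -> is_derive x 1 (g n) (w x * g n.+1 x).

Definition taylor_rem (m n : nat) (v : R) : R :=
  g m v - \sum_(k < n) g (m + k) u * Z v ^+ k / k`!%:R.

Let rem0 m v : taylor_rem m 0 v = g m v.
Proof. by rewrite /taylor_rem big_ord0 subr0. Qed.

Let remS m n v :
  taylor_rem m n.+1 v = taylor_rem m n v - g (m + n) u * Z v ^+ n / n`!%:R.
Proof. by rewrite /taylor_rem big_ord_recr /= opprD addrA. Qed.

Let rem_u m n : taylor_rem m n.+1 u = 0.
Proof.
elim: n => [|n IHn]; rewrite remS ?IHn Z_u.
  by rewrite rem0 addn0 expr0 mulr1 divr1 subrr.
by rewrite expr0n /= mulr0 mul0r subr0.
Qed.

Lemma taylor_rem_derive m n x : u <= x < 1 ->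
  is_derive x 1 (taylor_rem m n.+1) (w x * taylor_rem m.+1 n x).
Proof.
move=> ux; elim: n => [|n IHn].
  have -> : taylor_rem m 1 = (fun v => g m v - g m u).
    by apply/funext => v; rewrite remS rem0 addn0 expr0 mulr1 divr1.
  by rewrite rem0; apply: is_derive_eq (derB (g_derive m ux) (derC x _)) _; rewrite subr0.
have -> : taylor_rem m n.+2 =
    (fun v => taylor_rem m n.+1 v - g (m + n.+1) u / n.+1`!%:R * Z v ^+ n.+1).
  by apply/funext => v; rewrite remS mulrAC.
apply: (is_derive_eq (derB IHn (derCM _ (derX n.+1 (Z_derive ux))))).
rewrite remS [RHS]mulrBr; congr (_ - _).
rewrite addSnnS factS natrM /=.
have n0 : n`!%:R != 0 :> R by rewrite pnatr_eq0 -lt0n fact_gt0.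
by field; rewrite n0 addrC natr1 pnatr_eq0.
Qed.

(** The remainder vanishes at [u] and its derivative is a remainder of lower order
    of the next function, hence nonnegative by induction. *)
Lemma taylor_rem_ge0 m n v : u <= v < 1 -> 0 <= taylor_rem m n v.
Proof.
elim: n m v => [|n IHn] m v uv; first by rewrite rem0 g_ge0.
have /andP[uv1 v1] := uv.
rewrite -(rem_u m n); apply: (@is_derive_ge0_le _ _ (fun x => w x * taylor_rem m.+1 n x)) => //.
  by move=> x /andP[ux xv]; apply: taylor_rem_derive; rewrite ux (le_lt_trans xv).
move=> x /andP[ux xv]; have ux1 : u <= x < 1 by rewrite ltW ?(lt_trans xv).
by rewrite mulr_ge0 ?IHn // ltW ?w_gt0.
Qed.

Lemma Z_lt v v' : u <= v -> v < v' -> v' < 1 -> Z v < Z v'.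
Proof.
move=> uv vv' v'1; apply: (@is_derive_gt0_lt _ _ w) => //.
  by move=> x /andP[vx xv]; apply: Z_derive; rewrite (le_trans uv) ?(le_lt_trans xv).
by move=> x /andP[vx xv]; apply: w_gt0; rewrite (le_trans uv (ltW vx)) (lt_trans xv).
Qed.

Let Z_ge0 v : u <= v < 1 -> 0 <= Z v.
Proof.
move=> /andP[]; rewrite le_eqVlt => /predU1P[<-|uv] v1; first by rewrite Z_u.
by rewrite -Z_u ltW // Z_lt.
Qed.

Lemma taylor_rem_le m n v : u <= v < 1 -> taylor_rem m n v <= g m v.
Proof.
move=> uv; have /andP[uv' v1] := uv.
rewrite /taylor_rem lerBlDr lerDl sumr_ge0 // => k _.
by rewrite divr_ge0 ?mulr_ge0 ?g_ge0 ?exprn_ge0 ?Z_ge0 // lexx (le_lt_trans uv').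
Qed.

(** A Taylor series with nonnegative terms and nonnegative remainder is bounded,
    term by term, by the function. *)
Lemma taylor_coeff_le n v : u <= v < 1 -> g n u * Z v ^+ n / n`!%:R <= g 0 v.
Proof.
move=> uv; apply: le_trans (taylor_rem_le 0 n uv).
by have := taylor_rem_ge0 0 n.+1 uv; rewrite remS subr_ge0 add0n.
Qed.

(** The left-hand side below has the sign of the derivative of the quotient of the
    remainder by [Z ^+ n.+1]; its own derivative is the same quantity one order
    lower. *)
Let rem_growth m n v : u <= v < 1 ->
  0 <= Z v * taylor_rem m.+1 n v - n.+1%:R * taylor_rem m n.+1 v.
Proof.
elim: n m v => [|n IHn] m v uv; have /andP[uv' v1] := uv;
  pose S m n v := Z v * taylor_rem m.+1 n v - n.+1%:R * taylor_rem m n.+1 v;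
  rewrite -/(S _ _ v).
  have -> : 0 = S m 0%N u by rewrite /S Z_u !rem_u !(mul0r, mulr0) subr0.
  apply: (@is_derive_ge0_le _ _ (fun x => Z x * (w x * g m.+2 x))) => //.
    move=> x /andP[ux xv]; have ux1 : u <= x < 1 by rewrite ux (le_lt_trans xv).
    rewrite /S.
    have -> : taylor_rem m.+1 0 = g m.+1 by apply/funext => y; rewrite rem0.
    apply: (is_derive_eq (derB (derM (Z_derive ux1) (g_derive m.+1 ux1))
      (derCM _ (taylor_rem_derive m 0 ux1)))).
    by rewrite rem0; ring.
  move=> x /andP[ux xv]; have ux1 : u <= x < 1 by rewrite ltW ?(lt_trans xv).
  by rewrite !mulr_ge0 ?Z_ge0 ?g_ge0 // ltW ?w_gt0.
have -> : 0 = S m n.+1 u by rewrite /S Z_u !rem_u !(mul0r, mulr0) subr0.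
apply: (@is_derive_ge0_le _ _ (fun x => w x * S m.+1 n x)) => //.
  move=> x /andP[ux xv]; have ux1 : u <= x < 1 by rewrite ux (le_lt_trans xv).
  apply: (is_derive_eq (derB (derM (Z_derive ux1) (taylor_rem_derive m.+1 n ux1))
    (derCM _ (taylor_rem_derive m n.+1 ux1)))).
  by rewrite /S -(natr1 n.+1); ring.
move=> x /andP[ux xv]; have ux1 : u <= x < 1 by rewrite ltW ?(lt_trans xv).
by rewrite mulr_ge0 ?IHn // ltW ?w_gt0.
Qed.

(** The monotonicity behind Bernstein's theorem: it makes the remainder at [v] at most
    (Z v / Z v')^n times the remainder at a later [v'], so that it tends to 0. *)
Lemma taylor_rem_ratio_le m n v v' : u < v -> v <= v' -> v' < 1 ->
  taylor_rem m n v / Z v ^+ n <= taylor_rem m n v' / Z v' ^+ n.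
Proof.
case: n => [|n] uv vv' v'1.
  rewrite !expr0 !divr1 !rem0.
  apply: (@is_derive_ge0_le _ _ (fun x => w x * g m.+1 x)) => //.
    move=> x /andP[vx xv]; apply: g_derive.
    by rewrite (le_trans (ltW uv)) ?(le_lt_trans xv).
  move=> x /andP[vx xv].
  have ux1 : u <= x < 1 by rewrite (le_trans (ltW uv) (ltW vx)) (lt_trans xv).
  by rewrite mulr_ge0 ?g_ge0 // ltW ?w_gt0.
have Zx0 x : v <= x <= v' -> 0 < Z x.
  move=> /andP[vx xv]; rewrite -Z_u; apply: Z_lt => //.
    exact: lt_le_trans uv vx.
  exact: le_lt_trans xv v'1.
apply: (@is_derive_ge0_le _ (fun x => taylor_rem m n.+1 x / Z x ^+ n.+1) (fun x => w x * (Z x * taylor_rem m.+1 n x -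
    n.+1%:R * taylor_rem m n.+1 x) / Z x ^+ n.+2)) => //.
  move=> x xv; have /andP[vx xv'] := xv.
  have ux1 : u <= x < 1 by rewrite (le_trans (ltW uv)) ?(le_lt_trans xv').
  have Z0 : Z x != 0 by rewrite gt_eqF ?Zx0.
  apply: (is_derive_eq (derM (taylor_rem_derive m n ux1)
    (@derV _ _ (fun y => Z y ^+ n.+1) _ (expf_neq0 n.+1 Z0) (derX n.+1 (Z_derive ux1))))).
  by rewrite !exprS /=; field; rewrite Z0 expf_neq0.
move=> x /andP[vx xv].
have ux1 : u <= x < 1 by rewrite (le_trans (ltW uv) (ltW vx)) (lt_trans xv).
apply: divr_ge0; last by rewrite exprn_ge0 ?Z_ge0.
by apply: mulr_ge0; [rewrite ltW ?w_gt0 | exact: rem_growth].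
Qed.

(** The Taylor series converges to the function, and a geometric bound on its
    coefficients, of ratio less than the inverse of the total time [I], bounds the
    sum uniformly. *)
Lemma absolutely_monotone_bounded (I C r : R) :
  (forall v, u <= v < 1 -> Z v <= I) -> 0 <= r -> r * I < 1 -> 0 <= C ->
  (forall n, g n u / n`!%:R <= C * r ^+ n) ->
  forall v, u < v < 1 -> g 0 v <= C / (1 - r * I).
Proof.
move=> ZI r0 rI1 C0 gC v /andP[uv v1].
have uv1 : u <= v < 1 by rewrite ltW.
have Zv0 := Z_ge0 uv1.
have I0 : 0 <= I by apply: le_trans (Zv0) (ZI _ uv1).
pose v' := (v + 1) / 2.
have vv' : v < v' by rewrite /v'; lra.
have v'1 : v' < 1 by rewrite /v'; lra.
have uv'1 : u <= v' < 1 by rewrite v'1 (le_trans (ltW uv)) ?ltW.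
have Zvv' : Z v < Z v' by apply: Z_lt => //; exact: ltW.
pose k := Z v / Z v'.
have k1 : k < 1 by rewrite ltr_pdivrMr ?mul1r // (le_lt_trans Zv0).
have k0 : 0 <= k by rewrite divr_ge0 // ltW // (le_lt_trans Zv0).
have Zv_gt0 : 0 < Z v by rewrite -Z_u; apply: Z_lt.
have bound n : g 0 v <= k ^+ n * g 0 v' + C / (1 - r * I).
  have -> : g 0 v = taylor_rem 0 n v + \sum_(i < n) g i u * Z v ^+ i / i`!%:R.
    by rewrite /taylor_rem subrK.
  apply: lerD.
    have := taylor_rem_ratio_le 0 n uv (ltW vv') v'1.
    rewrite ler_pdivrMr ?exprn_gt0 // => /le_trans; apply.
    rewrite mulrAC -mulrA -expr_div_n -/k mulrC ler_wpM2l ?exprn_ge0 //.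
    exact: taylor_rem_le.
  apply: (@le_trans _ _ (\sum_(i < n) C * (r * I) ^+ i)).
    apply: ler_sum => i _; rewrite mulrAC exprMn mulrA.
    apply: ler_pM; rewrite ?exprn_ge0 ?divr_ge0 ?g_ge0 ?lexx ?(lt_trans uv) //.
    by apply: lerXn2r; rewrite ?nnegrE // ZI.
  rewrite -mulr_sumr ler_wpM2l //.
  have := subrX1 (r * I) n; rewrite -!(opprB 1) mulNr => /oppr_inj E.
  rewrite -[leRHS]mul1r ler_pdivlMr ?subr_gt0 // mulrC -E gerBl exprn_ge0 //.
  by rewrite mulr_ge0.
have kcvg : (fun n => k ^+ n * g 0 v' + C / (1 - r * I)) @ \oo --> C / (1 - r * I).
  rewrite -[X in _ --> X]add0r; apply: cvgD; last exact: cvg_cst.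
  rewrite -(mul0r (g 0 v')); apply: cvgMr_tmp.
  by apply: cvg_expr; rewrite ger0_norm.
rewrite -(cvg_lim (@Rhausdorff R) kcvg); apply: limr_ge; first exact: cvgP kcvg.
by apply: nearW => n; exact: bound.
Qed.

End AbsolutelyMonotone.

(** * Supermultiplicative sequences *)

Section Supermultiplicative.
Variable R : realType.
Implicit Types (c : nat -> R) (r rho sigma tau : R).

Lemma finite_positive_min c K : (forall n, 0 < c n) ->
  exists2 eps : R, 0 < eps & forall n, (n < K)%N -> eps <= c n.
Proof.
move=> c0; elim: K => [|K [eps eps0 IH]]; first by exists 1.
exists (Num.min eps (c K)); first by rewrite lt_min eps0 c0.
move=> n; rewrite ltnS leq_eqVlt => /predU1P[->|/IH le_c].
  by rewrite ge_min lexx orbT.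
by rewrite ge_min le_c.
Qed.

Lemma eventual_lower_bound c sigma K (C : R) : (forall n, 0 < c n) -> 0 < sigma ->
    0 < C -> (forall n, (K <= n)%N -> C * sigma ^+ n <= c n) ->
  exists2 C', 0 < C' & forall n, C' * sigma ^+ n <= c n.
Proof.
move=> c0 s0 C0 le_c.
have [|eps eps0 le_eps] := @finite_positive_min (fun n => c n / sigma ^+ n) K.
  by move=> n; rewrite divr_gt0 ?exprn_gt0.
exists (Num.min eps C); first by rewrite lt_min eps0.
move=> n; rewrite -ler_pdivlMr ?exprn_gt0 // ge_min.
have [/le_eps->//|/le_c Kn] := ltnP n K.
by apply/orP; right; rewrite ler_pdivlMr ?exprn_gt0.
Qed.

(** Because exp dominates each of its Taylor monomials. *)
Lemma polynomial_geometric_bound m r : 0 <= r < 1 ->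
  exists2 C : R, 0 < C & forall n, n%:R ^+ m * r ^+ n <= C.
Proof.
move=> /andP[]; rewrite le_eqVlt => /predU1P[<- _|r0 r1].
  exists 1 => // -[|n]; last by rewrite expr0n mulr0.
  by case: m => [|m]; rewrite !expr0 mulr1 ?expr0n.
case: m => [|m].
  by exists 1 => // n; rewrite expr0 mul1r exprn_ile1 // ltW.
have t0 : 0 < - ln r by rewrite oppr_gt0 ln_lt0 // r0.
have Q0 : 0 < m.+1`!%:R / (- ln r) ^+ m.+1 by rewrite divr_gt0 ?exprn_gt0 // ltr0n fact_gt0.
exists (m.+1`!%:R / (- ln r) ^+ m.+1) => // n.
have -> : r ^+ n = (expR (n%:R * - ln r))^-1.
  by rewrite mulrN expRN invrK -[in LHS](@lnK _ r) ?posrE // expRM_natl.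
rewrite ler_pdivrMr ?expR_gt0 // mulrAC ler_pdivlMr ?exprn_gt0 //.
rewrite -exprMn [leRHS]mulrC -ler_pdivrMr ?ltr0n ?fact_gt0 //.
apply: le_trans (expR_ge1Dxn m _); last by rewrite mulr_ge0 // ltW.
by rewrite lerDr.
Qed.

Lemma polynomial_le_geometric m sigma tau : 0 < sigma < tau ->
  exists2 C : R, 0 < C & forall n, n%:R ^+ m * sigma ^+ n <= C * tau ^+ n.
Proof.
move=> /andP[s0 st]; have t0 := lt_trans s0 st.
have [|C C0 CP] := @polynomial_geometric_bound m (sigma / tau).
  by rewrite divr_ge0 ?ltW //= ltr_pdivrMr // mul1r.
exists C => // n; have := CP n.
by rewrite expr_div_n mulrA ler_pdivrMr ?exprn_gt0.
Qed.

(** A Fekete lemma for sequences that are supermultiplicative up to a shift [m] of the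
    index and a polynomial loss of degree [m]. *)
Variables (c : nat -> R) (m : nat) (kappa : R).
Hypothesis c_gt0 : forall n, 0 < c n.
Hypothesis kappa_gt0 : 0 < kappa.
Hypothesis c_supermul : forall k l,
  kappa * c k * c l <= (k + l + m)%:R ^+ m * c (k + l + m)%N.

(** Shifted so that indices add up exactly. *)
Let e n := c (n - m).

Let e_supermul k l : (m <= k)%N -> (m <= l)%N ->
  kappa * e k * e l <= (k + l)%:R ^+ m * e (k + l).
Proof.
move=> mk ml; apply: le_trans (c_supermul _ _) _.
have -> : (k - m + (l - m) + m = k + l - m)%N by lia.
apply: ler_wpM2r; first exact: ltW.
by apply: lerXn2r; rewrite ?nnegrE // ler_nat leq_subr.
Qed.

Let loss N : R := (5 * N)%:R ^+ m / kappa.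

(** Splitting [q] into halves instead of peeling off one block at a time keeps the total
    loss exponential in [q]: a loss (q N)^m at each merge is paid by the factor
    [q%:R ^+ m] of the induction hypothesis and by 5^m, as q^2 <= 5 q1 q2 for the two
    halves q1 and q2.  Peeling would cost a power of q!. *)
Let e_multiple N q : (m <= N)%N -> (0 < N)%N -> (0 < q)%N ->
  loss N * q%:R ^+ m * (e N / loss N) ^+ q <= e (q * N).
Proof.
move=> mN N0 q0; set X := loss N.
have X0 : 0 < X by rewrite divr_gt0 ?exprn_gt0 // ltr0n muln_gt0.
have [M] := ubnP q; elim: M => // M IHM in q q0 *; rewrite ltnS => qM.
have [->|q1] := eqVneq q 1%N.
  by rewrite expr1n mulr1 expr1 mulrC divfK ?gt_eqF // mul1n.
pose q1' := q./2; pose q2 := uphalf q.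
have qE : q = (q1' + q2)%N by rewrite /q1' /q2; lia.
have IH1 : _ <= _ := IHM q1' ltac:(rewrite /q1'; lia) ltac:(rewrite /q1'; lia).
have IH2 : _ <= _ := IHM q2 ltac:(rewrite /q2; lia) ltac:(rewrite /q2; lia).
have mqN : (m <= q1' * N)%N by rewrite (leq_trans mN) // leq_pmull // /q1'; lia.
have mqN2 : (m <= q2 * N)%N by rewrite (leq_trans mN) // leq_pmull // /q2; lia.
have := e_supermul mqN mqN2; rewrite -mulnDl -qE => le_e.
have b0 : 0 < e N / X by rewrite divr_gt0 // c_gt0.
have qN0 : 0 < (q * N)%:R ^+ m :> R by rewrite exprn_gt0 // ltr0n muln_gt0 q0.
rewrite -(ler_pM2l qN0).
apply: le_trans le_e.
have step : kappa * (X * q1'%:R ^+ m * (e N / X) ^+ q1') * (X * q2%:R ^+ m * (e N / X) ^+ q2)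
    <= kappa * e (q1' * N) * e (q2 * N).
  have term_ge0 k : 0 <= X * k%:R ^+ m * (e N / X) ^+ k.
    by apply: mulr_ge0; [apply: mulr_ge0|]; rewrite ?exprn_ge0 // ltW.
  have kt_ge0 := mulr_ge0 (ltW kappa_gt0) (term_ge0 q1').
  by apply: ler_pM; rewrite ?ler_wpM2l // ltW.
apply: le_trans step.
have -> : kappa * (X * q1'%:R ^+ m * (e N / X) ^+ q1') * (X * q2%:R ^+ m * (e N / X) ^+ q2) =
    (kappa * X) * (q1' * q2)%:R ^+ m * X * (e N / X) ^+ q.
  by rewrite qE exprD natrM [in RHS]exprMn; ring.
rewrite mulrA; apply: ler_wpM2r; first by rewrite exprn_ge0 // ltW.
rewrite mulrCA mulrC; apply: ler_wpM2r; first exact: ltW.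
rewrite /X /loss [kappa * _]mulrC divfK ?gt_eqF // -!exprMn -!natrM.
apply: lerXn2r; rewrite ?nnegrE // ler_nat.
have : (q * q <= 5 * (q1' * q2))%N by rewrite /q1' /q2; nia.
by nia.
Qed.

(** One block of length [N], long enough for its gain to exceed the loss, is repeated
    n / N times; the rest of the length, kept between [N] and [2 N], is one more
    block. *)
Lemma supermultiplicative_lower rho sigma : 0 < sigma < rho ->
    (forall N0, exists2 N, (N0 <= N)%N & rho ^+ N <= c N) ->
  exists2 C, 0 < C & forall n, C * sigma ^+ n <= c n.
Proof.
move=> /andP[s0 sr] often.
pose tau1 := (sigma + rho) / 2; pose tau2 := (tau1 + rho) / 2.
have st1 : sigma < tau1 by rewrite /tau1; lra.
have t12 : tau1 < tau2 by rewrite /tau2 /tau1; lra.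
have t2r : tau2 < rho by rewrite /tau2 /tau1; lra.
have t10 := lt_trans s0 st1; have t20 := lt_trans t10 t12.
have r0 := lt_trans t20 t2r.
have [|A A0 AP] := @polynomial_le_geometric m tau1 tau2; first by rewrite t10.
have [|B B0 BP] := @polynomial_le_geometric m sigma tau1; first by rewrite s0.
(* The step from tau1 to tau2 absorbs the polynomial part of the loss, and (rho / tau2)^N
   exceeds the constant part for some large N. *)
have [N [mN N0 betaN]] : exists N, [/\ (m <= N)%N, (0 < N)%N &
    (5 * N)%:R ^+ m / kappa * tau1 ^+ N <= e N].
  have k1 : 0 <= tau2 / rho < 1 by rewrite divr_ge0 ?ltW //= ltr_pdivrMr // mul1r.
  have /cvgr_norm_lt /(_ (kappa * rho ^- m / (5 ^+ m * A))) :
      (fun n => (tau2 / rho) ^+ n) @ \oo --> (0 : R).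
    by apply: cvg_expr; rewrite ger0_norm; case/andP: k1.
  case=> [|K _ KP].
    by rewrite normr0 divr_gt0 ?mulr_gt0 ?invr_gt0 ?exprn_gt0.
  have [N + cN] := often (maxn K 1); rewrite geq_max => /andP[KN N0].
  exists (N + m)%N; split; [exact: leq_addl | exact: ltn_addr|]; rewrite /e addnK; apply: le_trans cN.
  have /KP /ltW /=  : (K <= N + m)%N by exact: leq_trans KN (leq_addr _ _).
  rewrite ger0_norm ?exprn_ge0 //; last by case/andP: k1.
  rewrite expr_div_n ler_pdivrMr ?exprn_gt0 // => le_t2.
  rewrite natrM exprMn mulrAC ler_pdivrMr // -mulrA.
  apply: (@le_trans _ _ (5 ^+ m * (A * tau2 ^+ (N + m)))).
    by rewrite ler_wpM2l ?exprn_ge0.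
  have fA0 : 0 < 5 ^+ m * A by rewrite mulr_gt0 ?exprn_gt0.
  rewrite mulrA mulrC -ler_pdivlMr //; apply: le_trans le_t2 _.
  have rm0 : rho ^+ m != 0 by rewrite expf_neq0 // gt_eqF.
  by rewrite mulrAC addnC exprD mulrA divfK // [_ * kappa]mulrC.
pose X := loss N.
have X0 : 0 < X by rewrite divr_gt0 ?exprn_gt0 // ltr0n muln_gt0.
have [|eps eps0 epsP] := @finite_positive_min (fun n => e n / tau1 ^+ n) (N + N).
  by move=> n; rewrite divr_gt0 ?exprn_gt0 // c_gt0.
apply: (@eventual_lower_bound c sigma (N + N) (kappa * X * eps / B * sigma ^+ m)) => //.
  apply: mulr_gt0; last exact: exprn_gt0.
  by apply: divr_gt0 => //; apply: mulr_gt0 => //; apply: mulr_gt0.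
move=> n' nn; pose n := (n' + m)%N.
have -> : c n' = e n by rewrite /e addnK.
rewrite -mulrA -exprD addnC -/n.
pose q := (n %/ N).-1; pose r := (n %% N + N)%N.
have n2 : (2 <= n %/ N)%N by rewrite leq_divRL // mul2n -addnn (leq_trans nn) ?leq_addr.
have q0 : (0 < q)%N by rewrite /q -ltnS prednK // ltnW.
have rN : (r < N + N)%N by rewrite /r ltn_add2r ltn_mod.
have nE : n = (q * N + r)%N.
  by rewrite /r /q addnCA -mulSnr prednK ?(ltnW n2) // addnC -divn_eq.
have le_q := e_multiple mN N0 q0.
have le_r : eps * tau1 ^+ r <= e r by rewrite -ler_pdivlMr ?exprn_gt0 //; apply: epsP.
have mq : (m <= q * N)%N by rewrite (leq_trans mN) // leq_pmull.
have mr : (m <= r)%N by rewrite (leq_trans mN) // leq_addl.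
have := e_supermul mq mr; rewrite -nE => le_n.
have le_tau : X * tau1 ^+ (q * N) <= e (q * N).
  apply: le_trans le_q; rewrite -mulrA; apply: ler_wpM2l; first exact: ltW.
  rewrite -[leLHS]mul1r; apply: ler_pM => //; first by rewrite exprn_ge0 // ltW.
    by rewrite exprn_ege1 // ler1n.
  have e0 : 0 < e N / X by rewrite divr_gt0 // c_gt0.
  rewrite mulnC exprM; apply: lerXn2r; rewrite ?nnegrE; [| exact: ltW |].
    by rewrite exprn_ge0 // ltW.
  by rewrite ler_pdivlMr // mulrC.
have n0 : 0 < n%:R ^+ m :> R by rewrite exprn_gt0 // ltr0n (leq_trans (ltnW n2)) // leq_div.
rewrite -(ler_pM2l n0); apply: le_trans le_n.
apply: (@le_trans _ _ (kappa * X * eps * tau1 ^+ n)).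
  have -> : n%:R ^+ m * (kappa * X * eps / B * sigma ^+ n) =
      kappa * X * eps * ((n%:R ^+ m * sigma ^+ n) / B) by ring.
  apply: ler_wpM2l; last by rewrite ler_pdivrMr // [leRHS]mulrC BP.
  by rewrite ltW // mulr_gt0 // mulr_gt0.
have -> : kappa * X * eps * tau1 ^+ n =
    kappa * (X * tau1 ^+ (q * N)) * (eps * tau1 ^+ r) by rewrite nE exprD; ring.
have kX0 : 0 < kappa * (X * tau1 ^+ (q * N)) by rewrite mulr_gt0 // mulr_gt0 // exprn_gt0.
apply: ler_pM => //; first exact: ltW.
  by rewrite ltW // mulr_gt0 // exprn_gt0.
by rewrite ler_wpM2l // ltW.
Qed.

End Supermultiplicative.

(** * Weighted histories of the urn *)

Section Histories.
Variables (R : realType) (a b p q : nat).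

(** The urn holds [i] bunches of [a] balls of the first color and [j] bunches of [b]
    balls of the second.  The truncated predecessors do no harm, as their terms have
    coefficient 0 when a color is absent.  On functions of two variables this is the n-th iterate of the
    derivation a Y^q d/dX + b X^p d/dY, taken from the first draw on. *)
Fixpoint hist (phi : nat -> nat -> R) (n i j : nat) : R :=
  if n is m.+1 then
    (a * i)%:R * hist phi m i.-1 (j + q) + (b * j)%:R * hist phi m (i + p) j.-1
  else phi i j.

Definition mon (X Y : R) (i j : nat) : R := X ^+ i * Y ^+ j.

Lemma ler_hist phi psi n i j :
  (forall i j, phi i j <= psi i j) -> hist phi n i j <= hist psi n i j.
Proof.
move=> le_phi; elim: n i j => [|n IHn] i j //=.
by rewrite lerD // ler_wpM2l.
Qed.

Lemma hist_ge0 phi n i j : (forall i j, 0 <= phi i j) -> 0 <= hist phi n i j.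
Proof.
move=> phi_ge0; elim: n i j => [|n IHn] i j //=.
by rewrite addr_ge0 // mulr_ge0.
Qed.

Lemma histD phi psi n i j :
  hist (fun i j => phi i j + psi i j) n i j = hist phi n i j + hist psi n i j.
Proof. by elim: n i j => [|n IHn] i j //=; rewrite !IHn; ring. Qed.

Lemma histZ k phi n i j :
  hist (fun i j => k * phi i j) n i j = k * hist phi n i j.
Proof. by elim: n i j => [|n IHn] i j //=; rewrite !IHn; ring. Qed.

Lemma mon_ge0 X Y i j : 0 <= X -> 0 <= Y -> 0 <= mon X Y i j.
Proof. by move=> *; rewrite mulr_ge0 ?exprn_ge0. Qed.

Lemma hist_mon_ge0 X Y n i j : 0 <= X -> 0 <= Y -> 0 <= hist (mon X Y) n i j.
Proof. by move=> *; apply: hist_ge0 => *; apply: mon_ge0. Qed.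

(** Each draw adds [s] balls to the total. *)
Lemma hist_homogeneous (s : nat) d phi n i j :
  (a * p = b + s)%N -> (b * q = a + s)%N ->
  hist (fun i j => d ^+ (a * i + b * j) * phi i j) n i j =
  d ^+ (a * i + b * j + s * n) * hist phi n i j.
Proof.
move=> apE bqE; elim: n i j => [|n IHn] i j /=; first by rewrite muln0 addn0.
rewrite !IHn mulrDr; congr (_ + _).
  case: i => [|i]; first by rewrite muln0 !mul0r mulr0.
  rewrite mulrCA /=; congr (_ ^+ _ * _).
  by rewrite mulnDr bqE !mulnS; ring.
case: j => [|j]; first by rewrite muln0 !mul0r mulr0.
rewrite mulrCA /=; congr (_ ^+ _ * _).
by rewrite mulnDr apE !mulnS; ring.
Qed.

(** The inequality part of Leibniz' rule: among the histories of a composed urn are those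
    which make [k] draws in the first sub-urn and [l] in the second, the two kinds
    of draws being shuffled arbitrarily. *)
Lemma hist_monM X Y k l i j i' j' : 0 <= X -> 0 <= Y ->
  'C(k + l, k)%:R * hist (mon X Y) k i j * hist (mon X Y) l i' j' <=
  hist (mon X Y) (k + l) (i + i') (j + j').
Proof.
move=> X0 Y0; have h0 n i1 j1 := @hist_mon_ge0 X Y n i1 j1 X0 Y0.
have [n] := ubnP (k + l)%N; elim: n => // n IHn in k l i j i' j' *.
rewrite ltnS => kln.
have split_step m i1 j1 : hist (mon X Y) m.+1 (i1 + i') (j1 + j') =
   (a * i1)%:R * hist (mon X Y) m (i1.-1 + i') (j1 + q + j') +
   (b * j1)%:R * hist (mon X Y) m (i1 + p + i') (j1.-1 + j') +
   ((a * i')%:R * hist (mon X Y) m (i1 + i'.-1) (j1 + (j' + q)) +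
   (b * j')%:R * hist (mon X Y) m (i1 + (i' + p)) (j1 + j'.-1)).
  rewrite /= !mulnDr !natrD !mulrDl addrACA; congr (_ + _ + (_ + _)).
  - by case: i1 => [|i1]; [rewrite muln0 !mul0r | rewrite /= -addnA (addnC j') addnA].
  - by case: j1 => [|j1]; [rewrite muln0 !mul0r | rewrite /= -addnA (addnC i') addnA].
  - by case: i' {IHn} => [|i']; [rewrite muln0 !mul0r | rewrite addnS /= addnA].
  - by case: j' {IHn} => [|j']; [rewrite muln0 !mul0r | rewrite addnS /= addnA].
case: k l kln => [|k] [|l] kln.
- by rewrite bin0 mul1r /= /mon !exprD mulrACA.
- rewrite add0n bin0 mul1r split_step.
  have -> : hist (mon X Y) 0 i j * hist (mon X Y) l.+1 i' j' =
     (a * i')%:R * (hist (mon X Y) 0 i j * hist (mon X Y) l i'.-1 (j' + q)) +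
     (b * j')%:R * (hist (mon X Y) 0 i j * hist (mon X Y) l (i' + p) j'.-1).
    by rewrite /=; ring.
  apply: (@le_trans _ _ (0 + _)); first by rewrite add0r.
  apply: lerD; first by rewrite addr_ge0 // mulr_ge0.
  apply: lerD; apply: ler_wpM2l => //.
    by have := IHn 0%N l i j i'.-1 (j' + q)%N kln; rewrite add0n bin0 mul1r.
  by have := IHn 0%N l i j (i' + p)%N j'.-1 kln; rewrite add0n bin0 mul1r.
- rewrite addn0 binn mul1r split_step.
  have -> : hist (mon X Y) k.+1 i j * hist (mon X Y) 0 i' j' =
     (a * i)%:R * (hist (mon X Y) k i.-1 (j + q) * hist (mon X Y) 0 i' j') +
     (b * j)%:R * (hist (mon X Y) k (i + p) j.-1 * hist (mon X Y) 0 i' j').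
    by rewrite /=; ring.
  apply: (@le_trans _ _ (_ + 0)); first by rewrite addr0.
  apply: lerD; last by rewrite addr_ge0 // mulr_ge0.
  rewrite addn0 in kln.
  apply: lerD; apply: ler_wpM2l => //.
    have := IHn k 0%N i.-1 (j + q)%N i' j'; rewrite addn0 binn mul1r; exact.
  have := IHn k 0%N (i + p)%N j.-1 i' j'; rewrite addn0 binn mul1r; exact.
rewrite addSn split_step.
(* Pascal's rule: the first draw falls in the first sub-urn or in the second. *)
have -> : 'C((k + l.+1).+1, k.+1)%:R * hist (mon X Y) k.+1 i j * hist (mon X Y) l.+1 i' j' =
   ((a * i)%:R * ('C(k + l.+1, k)%:R * hist (mon X Y) k i.-1 (j + q) * hist (mon X Y) l.+1 i' j') +
    (b * j)%:R * ('C(k + l.+1, k)%:R * hist (mon X Y) k (i + p) j.-1 * hist (mon X Y) l.+1 i' j')) +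
   ((a * i')%:R * ('C(k.+1 + l, k.+1)%:R * hist (mon X Y) k.+1 i j * hist (mon X Y) l i'.-1 (j' + q)) +
    (b * j')%:R * ('C(k.+1 + l, k.+1)%:R * hist (mon X Y) k.+1 i j * hist (mon X Y) l (i' + p) j'.-1)).
  by rewrite binS natrD -addSnnS /=; ring.
apply: lerD; apply: lerD; apply: ler_wpM2l => //; first exact: IHn.
- exact: IHn.
- by rewrite -addSnnS; apply: IHn; rewrite addSnnS.
- by rewrite -addSnnS; apply: IHn; rewrite addSnnS.
Qed.

End Histories.

(** * The functions delta and K *)

Section Kernel.
Variables (R : realType) (a b s : nat).
Hypotheses (a_gt0 : (0 < a)%N) (b_gt0 : (0 < b)%N) (s_gt0 : (0 < s)%N).

Notation h := (urn_h a b s).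
Notation dl := (@urn_delta R a b s).
Notation leb := (@lebesgue_measure R).

Let h_gt0 : (0 < h)%N. Proof. by rewrite /urn_h !addn_gt0 a_gt0. Qed.

Lemma is_derive_continuous (f : R -> R) (x df : R) :
  is_derive x 1 f df -> {for x, continuous f}.
Proof. by move=> fx; apply: differentiable_continuous; apply/derivable1_diffP; apply: ex_derive. Qed.

Lemma unit_expn (u : R) n : (0 < n)%N -> 0 < u < 1 -> 0 < u ^+ n < 1.
Proof. by move=> n0 /andP[u0 u1]; rewrite exprn_gt0 //= exprn_ilt1 ?ltW // -lt0n. Qed.

Lemma delta_gt0 (u : R) : 0 < u < 1 -> 0 < dl u.
Proof. by move=> /(unit_expn h_gt0)/andP[_ u1]; rewrite powR_gt0 // subr_gt0. Qed.

Lemma delta_expn (u : R) : 0 < u < 1 -> dl u ^+ h = 1 - u ^+ h.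
Proof.
move=> /(unit_expn h_gt0)/andP[_ u1].
rewrite -powR_mulrn ?powR_ge0 // -powRrM mulVf ?pnatr_eq0 -?lt0n //.
by rewrite powRr1 // subr_ge0 ltW.
Qed.

(** From delta^h = 1 - u^h. *)
Lemma delta_derive (u : R) : 0 < u < 1 ->
  is_derive u 1 dl (- (u ^+ h.-1 * dl u / dl u ^+ h)).
Proof.
move=> u01; have /andP[_ u1] := unit_expn h_gt0 u01.
have uh1 : 0 < 1 - u ^+ h by rewrite subr_gt0.
have pw : is_derive (1 - u ^+ h) 1 (@powR R ^~ h%:R^-1)
    (h%:R^-1 * (1 - u ^+ h) `^ (h%:R^-1 - 1)) by apply: is_derive1_powR.
have inn : is_derive u 1 (fun y : R => 1 - y ^+ h) (0 - h%:R * u ^+ h.-1 * 1).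
  exact: (derB (derC _ _) (derX h (is_derive_id u 1))).
have comp : is_derive u 1 dl (_ * _) :=
  @is_derive1_comp R (@powR R ^~ h%:R^-1) (fun y => 1 - y ^+ h) u _ _ pw inn.
apply: (is_derive_eq comp).
rewrite powRB; last by rewrite (gt_eqF uh1) implybT.
rewrite powRr1 ?ltW // -/(dl u) -delta_expn //.
have hn0 : h%:R != 0 :> R by rewrite pnatr_eq0 -lt0n.
by field; rewrite hn0 expf_neq0 // gt_eqF // delta_gt0.
Qed.

(** Bernoulli's inequality for 1 - u^h. *)
Lemma delta_expn_le (u : R) : 0 < u < 1 -> dl u ^+ h <= h%:R * (1 - u).
Proof.
move=> u01; rewrite delta_expn //; have /andP[u0 u1] := u01.
elim: {1 2}h => [|n IHn]; first by rewrite expr0 subrr mul0r.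
rewrite exprS -natr1 mulrDl mul1r.
have : u * (1 - u ^+ n) <= 1 - u ^+ n.
  by rewrite ler_piMl ?(ltW u1) // subr_ge0 exprn_ile1 ?ltW.
by lra.
Qed.

Lemma delta_small (eps : R) : 0 < eps ->
  exists2 v : R, 0 < v < 1 & forall x, v <= x < 1 -> dl x < eps.
Proof.
move=> eps0; have h0 : 0 < h%:R :> R by rewrite ltr0n.
pose e := Num.min (1 / 2) (eps ^+ h / h%:R / 2).
have e0 : 0 < e by rewrite lt_min !divr_gt0 ?exprn_gt0.
have e1 : e <= 1 / 2 by rewrite ge_min lexx.
have e2 : e <= eps ^+ h / h%:R / 2 by rewrite ge_min lexx orbT.
have q0 : 0 < eps ^+ h / h%:R by rewrite divr_gt0 ?exprn_gt0.
exists (1 - e) => [|x /andP[vx x1]]; first by lra.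
have x01 : 0 < x < 1 by lra.
rewrite -(@ltr_pXn2r _ h) ?nnegrE //; [|exact/ltW/delta_gt0 | exact: ltW].
apply: le_lt_trans (delta_expn_le x01) _.
by rewrite mulrC -ltr_pdivlMr //; lra.
Qed.

Definition kernel_density (t : R) : R := t ^+ (a - 1) / dl t ^+ (a + b).

Definition kernel_tail (u : R) : R :=
  \int[leb]_(t in `]u, 1[%classic) kernel_density t.

Lemma urn_KE u : urn_K a b s u = (dl u ^+ s)^-1 * kernel_tail u.
Proof. by []. Qed.

Lemma kernel_density_gt0 (t : R) : 0 < t < 1 -> 0 < kernel_density t.
Proof.
by move=> t01; rewrite divr_gt0 ?exprn_gt0 ?delta_gt0 //; case/andP: t01.
Qed.

Lemma inv_delta_derive (n : nat) (t : R) : 0 < t < 1 ->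
  is_derive t 1 (fun y => (dl y ^+ n)^-1) (n%:R * t ^+ h.-1 / dl t ^+ (h + n)).
Proof.
move=> t01; have d0 : dl t != 0 by rewrite gt_eqF // delta_gt0.
apply: (is_derive_eq (@derV _ _ (fun y => dl y ^+ n) _ (expf_neq0 n d0)
   (derX n (delta_derive t01)))).
case: n => [|n]; first by rewrite !mul0r oppr0 mul0r.
by rewrite exprD !exprS /=; field; rewrite d0 !expf_neq0.
Qed.

Lemma kernel_density_continuous (t : R) : 0 < t < 1 -> {for t, continuous kernel_density}.
Proof.
move=> t01; apply: (@is_derive_continuous _ _ _ (derM (derX (a - 1) (is_derive_id t 1)) (inv_delta_derive (a + b) t01))).
Qed.

Lemma delta_pow_derive (t : R) : 0 < t < 1 ->
  is_derive t 1 (fun y => dl y ^+ s) (- (s%:R * (t ^+ h.-1 / dl t ^+ (a + b)))).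
Proof.
move=> t01; have d0 : dl t != 0 by rewrite gt_eqF // delta_gt0.
apply: (is_derive_eq (derX s (delta_derive t01))).
have -> : dl t ^+ h = dl t ^+ (a + b) * (dl t * dl t ^+ s.-1).
  by rewrite -exprS prednK // -exprD.
by field; rewrite d0 !expf_neq0.
Qed.

Let majorant (t : R) : R := t ^+ h.-1 / dl t ^+ (a + b).

(** The majorant has an antiderivative, a multiple of delta^s, which is continuous at 1;
    this is why the singularity of the integrand at 1 is integrable. *)
Lemma kernel_density_le (u t : R) : 0 < u <= t -> t < 1 ->
  kernel_density t <= (u ^+ (b + s))^-1 * majorant t.
Proof.
move=> /andP[u0 ut] t1; have t01 : 0 < t < 1 by rewrite t1 (lt_le_trans u0).
have t0 : 0 < t by case/andP: t01.
rewrite /kernel_density /majorant [leRHS]mulrA ler_wpM2r //.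
  by rewrite invr_ge0 exprn_ge0 // ltW // delta_gt0.
have -> : (h.-1 = (a - 1) + (b + s))%N by rewrite /urn_h subn1 -addnA -!subn1 addnBAC.
rewrite [t ^+ (_ + (_ + _))]exprD mulrCA ler_peMr ?exprn_ge0 ?(ltW t0) // mulrC ler_pdivlMr ?exprn_gt0 //.
by rewrite mul1r lerXn2r // nnegrE ltW.
Qed.

Lemma segment_integrable (u v : R) : 0 < u -> v < 1 ->
  leb.-integrable `[u, v] (EFin \o kernel_density).
Proof.
move=> u0 v1; apply: continuous_compact_integrable; first exact: segment_compact.
apply: continuous_in_subspaceT => x; rewrite inE/= in_itv/= => /andP[ux xv].
by apply: kernel_density_continuous; rewrite (lt_le_trans u0) // (le_lt_trans xv).
Qed.

Lemma segment_integral_le (u v : R) : 0 < u -> u < v -> v < 1 ->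
  (\int[leb]_(t in `[u, v]) (kernel_density t)%:E <=
   ((u ^+ (b + s))^-1 * (dl u ^+ s / s%:R))%:E)%E.
Proof.
move=> u0 uv v1.
pose F t := (u ^+ (b + s))^-1 * (- (s%:R^-1 * dl t ^+ s)).
have s0 : 0 < s%:R :> R by rewrite ltr0n.
have in01 t : u <= t <= v -> 0 < t < 1.
  by move=> /andP[ut tv]; rewrite (lt_le_trans u0) // (le_lt_trans tv).
have FD t : u <= t <= v -> is_derive t 1 F ((u ^+ (b + s))^-1 * majorant t).
  move=> /in01 t01; apply: (is_derive_eq (derCM _ (derN (derCM _ (delta_pow_derive t01))))).
  by congr (_ * _); rewrite mulrN opprK mulKf ?gt_eqF.
have cont : {within `[u, v], continuous (fun t => (u ^+ (b + s))^-1 * majorant t)}.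
  apply: continuous_in_subspaceT => t; rewrite inE/= in_itv/= => /in01 t01.
  apply: (@is_derive_continuous _ _ _ (derCM _ (derM (derX h.-1 (is_derive_id t 1)) (inv_delta_derive (a + b) t01)))).
have Fc t : u <= t <= v -> {for t, continuous F}.
  by move=> /FD; apply: is_derive_continuous.
have E := @continuous_FTC2 R (fun t => (u ^+ (b + s))^-1 * majorant t) F u v uv cont.
apply: (@le_trans _ _ (\int[leb]_(t in `[u, v]) ((u ^+ (b + s))^-1 * majorant t)%:E)%E).
  apply: le_integral.
  - by [].
  - exact: segment_integrable.
  - by apply: continuous_compact_integrable => //; exact: segment_compact.
  - move=> t; rewrite inE/= in_itv/= => /andP[ut tv].
    by rewrite lee_fin kernel_density_le ?u0 //= (le_lt_trans tv).
rewrite E.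
- rewrite -EFinB lee_fin /F -mulrBr ler_wpM2l ?invr_ge0 ?exprn_ge0 ?(ltW u0) //.
  rewrite opprK addrC mulrC gerBl mulr_ge0 ?invr_ge0 ?exprn_ge0 ?ltW //.
  by rewrite delta_gt0 // in01 // lexx ltW.
- split.
  + move=> t; rewrite in_itv/= => /andP[ut tv].
    have tuv : u <= t <= v by rewrite !ltW.
    exact: (@ex_derive _ _ _ _ _ _ _ (FD _ tuv)).
  + by apply: cvg_at_right_filter; apply: Fc; rewrite lexx ltW.
  + by apply: cvg_at_left_filter; apply: Fc; rewrite lexx ltW.
- move=> t; rewrite in_itv/= => /andP[ut tv].
  have tuv : u <= t <= v by rewrite !ltW.
  rewrite derive1E; exact: (@derive_val _ _ _ _ _ _ _ (FD _ tuv)).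
Qed.

End Kernel.

Section KernelTail.
Variables (R : realType) (a b s : nat).
Hypotheses (a_gt0 : (0 < a)%N) (b_gt0 : (0 < b)%N) (s_gt0 : (0 < s)%N).

Notation h := (urn_h a b s).
Notation dl := (@urn_delta R a b s).
Notation leb := (@lebesgue_measure R).
Notation f := (@kernel_density R a b s).
Notation tail := (@kernel_tail R a b s).

Let f_gt0 (t : R) : 0 < t < 1 -> 0 < f t. Proof. exact: kernel_density_gt0. Qed.

Let f_measurable (u : R) : 0 < u -> measurable_fun (`[u, 1[%classic : set R) f.
Proof.
move=> u0; apply: (@measurable_funS _ _ _ _ (`]0, 1[%classic : set R)) => //.
  by move=> x /=; rewrite !in_itv/= => /andP[ux ->]; rewrite (lt_le_trans u0).
apply: open_continuous_measurable_fun; first exact: interval_open.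
by move=> x; rewrite inE/= in_itv/= => x01; apply: kernel_density_continuous.
Qed.

Let right_end (u : R) (n : nat) : R := 1 - (1 - u) / n.+2%:R.

Let right_end_in (u : R) n : 0 < u < 1 -> u < right_end u n < 1.
Proof.
move=> /andP[u0 u1]; have u10 : 0 < 1 - u by rewrite subr_gt0.
apply/andP; split; last by rewrite gtrBl divr_gt0.
rewrite ltrBrDl -ltrBrDr ltr_pdivrMr // ltr_pMr // ltr1n //.
Qed.

(** By monotone convergence along segments that exhaust the interval. *)
Let tail_ext_le (u : R) : 0 < u < 1 ->
  (\int[leb]_(t in `[u, 1%R[) (f t)%:E <= ((u ^+ (b + s))^-1 * (dl u ^+ s / s%:R))%:E)%E.
Proof.
move=> u01; have /andP[u0 u1] := u01.
have -> : `[u, 1[%classic = \bigcup_n `[u, right_end u n]%classic.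
  apply/seteqP; split => x /=.
    rewrite in_itv/= => /andP[ux x1].
    have e0 : 0 < (1 - x) by rewrite subr_gt0.
    
    exists (Num.truncn ((1 - u) / (1 - x))) => //=; rewrite in_itv/= ux /=.
    rewrite /right_end lerBrDl -lerBrDr ler_pdivrMr // mulrC -ler_pdivrMr //.
    apply/ltW; apply: lt_trans (truncnS_gt _) _; by rewrite ltr_nat.
  move=> [n _]; rewrite /= !in_itv/= => /andP[-> xv].
  by apply: le_lt_trans xv _; case/andP: (right_end_in n u01).
have F_mono : nondecreasing_seq (fun n => `[u, right_end u n]%classic).
  move=> m n mn; apply/subsetPset => x /=; rewrite !in_itv/= => /andP[-> xm] /=.
  apply: le_trans xm _; rewrite /right_end lerB // ler_pM2l ?subr_gt0 //.
  by rewrite lef_pV2 ?posrE // ler_nat.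
have F_meas i : measurable_fun (`[u, right_end u i]%classic : set R) f.
  apply: measurable_funS (f_measurable u0) => // x /=; rewrite !in_itv/= => /andP[-> xv].
  by apply: le_lt_trans xv _; case/andP: (right_end_in i u01).
have F_pos i x : `[u, right_end u i]%classic x -> (0 <= (EFin \o f) x)%E.
  rewrite /= in_itv/= lee_fin => /andP[ux xv]; apply/ltW/f_gt0.
  rewrite (lt_le_trans u0 ux) (le_lt_trans xv) //.
  by case/andP: (right_end_in i u01).
have F_cvg := @ge0_nondecreasing_set_cvg_integral _ (measurableTypeR R) R
  (fun n => `[u, right_end u n]%classic) (EFin \o f) leb F_mono
  (fun i => measurable_itv _) (fun i => iffRL (measurable_EFinP _ _) (F_meas i)) F_pos.
rewrite -(cvg_lim _ F_cvg) //; apply: lime_le; first exact: cvgP F_cvg.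
apply: nearW => n; have /andP[uv v1] := right_end_in n u01.
exact: segment_integral_le.
Qed.

Lemma tail_integrable_co (u : R) : 0 < u < 1 -> leb.-integrable `[u, 1[ (EFin \o f).
Proof.
move=> u01; have /andP[u0 u1] := u01; apply/integrableP; split.
  by apply/measurable_EFinP; exact: f_measurable.
apply: le_lt_trans (ltry ((u ^+ (b + s))^-1 * (dl u ^+ s / s%:R))).
apply: le_trans (tail_ext_le u01).
rewrite le_eqVlt; apply/orP; left; apply/eqP; apply: eq_integral => t.
rewrite inE/= in_itv/= => /andP[ut t1].
by rewrite /= ger0_norm // ltW // f_gt0 // t1 (lt_le_trans u0).
Qed.

Lemma tail_integrable (u : R) : 0 < u < 1 -> leb.-integrable `]u, 1[ (EFin \o f).
Proof.
move=> u01; apply: integrableS (tail_integrable_co u01) => //.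
by apply: subset_itvr; rewrite bnd_simp.
Qed.

Lemma kernel_tail_ge0 (u : R) : 0 < u -> 0 <= tail u.
Proof.
move=> u0; apply: Rintegral_ge0 => x /=; rewrite in_itv/= => /andP[ux x1].
by rewrite ltW // f_gt0 // x1 (lt_trans u0).
Qed.

Lemma kernel_tail_le (u : R) : 0 < u < 1 ->
  tail u <= (u ^+ (b + s))^-1 * (dl u ^+ s / s%:R).
Proof.
move=> u01; rewrite /kernel_tail Rintegral_itv_obnd_cbnd; last exact: tail_integrable.
rewrite -lee_fin /Rintegral fineK; first exact: tail_ext_le.
by apply: integrable_fin_num => //; exact: tail_integrable_co.
Qed.

Lemma kernel_tail_derive (u : R) : 0 < u < 1 -> is_derive u 1 tail (- f u).
Proof.
move=> u01; have /andP[u0 u1] := u01.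
pose c := u / 2; pose e := (u + 1) / 2.
have cu : c < u by rewrite /c; lra.
have c0 : 0 < c by rewrite /c; lra.
have ue : u < e by rewrite /e; lra.
have e1 : e < 1 by rewrite /e; lra.
have c01 : 0 < c < 1 by rewrite c0 (lt_trans cu).
have fi : leb.-integrable `]c, e] (EFin \o f).
  apply: integrableS (tail_integrable c01) => // x /=.
  by rewrite !in_itv/= => /andP[-> xe]; rewrite (le_lt_trans xe).
have [||dF F'] := @continuous_FTC1 R f (BRight c) u e ue fi.
- by [].
- exact: kernel_density_continuous.
pose F x := \int[leb]_(t in [set` Interval (BRight c) (BRight x)]) f t.
have FD : is_derive u 1 F (f u) by apply: DeriveDef; [exact: dF | rewrite -derive1E; exact: F'].
have TD : is_derive u 1 (fun x => tail c - F x) (- f u).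
  by apply: (is_derive_eq (derB (derC u (tail c)) FD)); rewrite sub0r.
apply: near_eq_is_derive TD.
near=> x; rewrite /kernel_tail /F Rintegral_itvB //.
- exact: tail_integrable.
- rewrite bnd_simp ltW //; near: x; exact: lt_nbhsr.
- rewrite bnd_simp; near: x; exact: lt_nbhsl.
Unshelve. all: by end_near. Qed.

End KernelTail.

(** * The optimal parameter *)

Section Optimum.
Variables (R : realType) (a b s : nat).
Hypotheses (a_gt0 : (0 < a)%N) (b_gt0 : (0 < b)%N) (s_gt0 : (0 < s)%N).

Notation h := (urn_h a b s).
Notation dl := (@urn_delta R a b s).
Notation f := (@kernel_density R a b s).
Notation tail := (@kernel_tail R a b s).
Notation K := (@urn_K R a b s).

Let h_gt0 : (0 < h)%N. Proof. by rewrite /urn_h !addn_gt0 a_gt0. Qed.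
Let s0 : 0 < s%:R :> R. Proof. by rewrite ltr0n. Qed.

Lemma delta_lt1 (u : R) : 0 < u < 1 -> dl u < 1.
Proof.
move=> u01; rewrite -(@ltr_pXn2r _ h) ?nnegrE //; last exact/ltW/delta_gt0.
by rewrite delta_expn // expr1n gtrBl; case/andP: (unit_expn h_gt0 u01).
Qed.

Lemma kernel_tail_lt (u v : R) : 0 < u -> u < v -> v < 1 -> tail v < tail u.
Proof.
move=> u0 uv v1.
have in01 (x : R) : u <= x <= v -> 0 < x < 1.
  by move=> /andP[ux xv]; rewrite (lt_le_trans u0) // (le_lt_trans xv).
apply: (@is_derive_lt0_gt _ _ (fun x => - f x)) => //.
  by move=> x /in01; exact: kernel_tail_derive.
move=> x /andP[ux xv]; rewrite oppr_lt0 kernel_density_gt0 // in01 //.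
by rewrite !ltW.
Qed.

Lemma kernel_tail_gt0 (u : R) : 0 < u < 1 -> 0 < tail u.
Proof.
move=> /andP[u0 u1]; have um : u < (u + 1) / 2 by lra.
have m1 : (u + 1) / 2 < 1 by lra.
apply: le_lt_trans (kernel_tail_lt u0 um m1); apply: kernel_tail_ge0 => //.
exact: lt_trans um.
Qed.

Lemma kernel_tail_small (u eta : R) : 0 < u < 1 -> 0 < eta ->
  exists v : R, u < v < 1 /\ tail v < eta.
Proof.
move=> /andP[u0 u1] eta0.
pose eps := Num.min 1 (eta * u ^+ (b + s) * s%:R).
have eps0 : 0 < eps by rewrite lt_min ltr01 !mulr_gt0 ?exprn_gt0.
have [z /andP[z0 z1] zP] := delta_small b s a_gt0 eps0.
pose v := Num.max z ((u + 1) / 2).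
have v1 : v < 1 by rewrite gt_max z1; lra.
have uv : u < v by rewrite lt_max; apply/orP; right; lra.
have v0 := lt_trans u0 uv; have v01 : 0 < v < 1 by rewrite v0.
have dv : dl v < eps by apply: zP; rewrite v1 le_max lexx.
exists v; split; first by rewrite uv.
apply: le_lt_trans (kernel_tail_le b a_gt0 s_gt0 v01) _.
rewrite mulrC ltr_pdivrMr ?exprn_gt0 // ltr_pdivrMr //.
apply: (@le_lt_trans _ _ (dl v)).
  rewrite -{2}[dl v]expr1; apply: ler_wiXn2l => //; apply/ltW; first exact: delta_gt0.
  exact: delta_lt1.
apply: lt_le_trans dv _; rewrite ge_min; apply/orP; right.
by rewrite ler_pM2r // ler_pM2l // lerXn2r // ?nnegrE ltW.
Qed.

Lemma urn_K_gt0 (u : R) : 0 < u < 1 -> 0 < K u.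
Proof.
by move=> u01; rewrite urn_KE mulr_gt0 ?invr_gt0 ?exprn_gt0 ?delta_gt0 ?kernel_tail_gt0.
Qed.

Lemma urn_K_derive (u : R) : 0 < u < 1 ->
  is_derive u 1 K ((s%:R * u ^+ h.-1 * K u - u ^+ (a - 1)) / dl u ^+ h).
Proof.
move=> u01; have d0 : dl u != 0 by rewrite gt_eqF // delta_gt0.
have KD : is_derive u 1 K (_ + _) :=
  derM (inv_delta_derive b s a_gt0 s u01) (kernel_tail_derive b a_gt0 s_gt0 u01).
apply: (is_derive_eq KD).
have -> : dl u ^+ (h + s) = dl u ^+ (a + b) * dl u ^+ s * dl u ^+ s.
  by rewrite -!exprD.
have -> : dl u ^+ h = dl u ^+ (a + b) * dl u ^+ s by rewrite -exprD.
by rewrite urn_KE /kernel_density; field; rewrite !expf_neq0.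
Qed.

(** K(u) = u^a / critical_denom xi u is the equation u K'(u) / K(u) + xi = 0, solved
    for K(u) with the help of the value of K'(u). *)
Definition critical_denom (xi u : R) : R := xi + (s%:R - xi) * u ^+ h.

Definition critical_gap (xi u : R) : R :=
  tail u - u ^+ a * dl u ^+ s / critical_denom xi u.

Lemma critical_denom_ge (xi u : R) : 0 < xi -> xi < s%:R -> 0 < u < 1 ->
  xi <= critical_denom xi u.
Proof.
move=> xi0 xis /(unit_expn h_gt0)/andP[U0 U1].
by rewrite lerDl mulr_ge0 ?subr_ge0 // ltW.
Qed.

Lemma critical_denom_gt0 (xi u : R) : 0 < xi -> xi < s%:R -> 0 < u < 1 ->
  0 < critical_denom xi u.
Proof. by move=> xi0 xis u01; apply: lt_le_trans (critical_denom_ge xi0 xis u01). Qed.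

(** The logarithmic derivative of u^xi K(u) has the sign of the gap. *)
Lemma urn_K_log_derive (xi u : R) : 0 < xi -> xi < s%:R -> 0 < u < 1 ->
  u * derive1 K u / K u + xi =
  critical_denom xi u * critical_gap xi u / (dl u ^+ s * dl u ^+ h * K u).
Proof.
move=> xi0 xis u01; have /andP[u0 u1] := u01.
rewrite derive1E (@derive_val _ _ _ _ _ _ _ (urn_K_derive u01)).
have d0 : dl u != 0 by rewrite gt_eqF // delta_gt0.
have B0 := lt0r_neq0 (critical_denom_gt0 xi0 xis u01).
have T0 := lt0r_neq0 (kernel_tail_gt0 u01).
have U1 : 1 - u ^+ h != 0 by rewrite -delta_expn // expf_neq0.
rewrite urn_KE /critical_gap delta_expn //; move: B0; rewrite /critical_denom.
have -> : u ^+ a = u * u ^+ (a - 1) by rewrite subn1 -exprS prednK.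
have hE : u ^+ h = u * u ^+ h.-1 by rewrite -exprS prednK.
rewrite hE in U1 *.
move: (u ^+ (a - 1)) (u ^+ h.-1) (dl u ^+ s) (expf_neq0 s d0) U1 => A H V V0 U1 B0.
by field; rewrite V0 U1 B0 T0.
Qed.

(** The sign of the derivative is that of an affine function of u^h: the numerator is a
    quadratic polynomial in u^h which has the root 1. *)
Lemma critical_gap_derive (xi u : R) : 0 < xi -> xi < s%:R -> 0 < u < 1 ->
  is_derive u 1 (critical_gap xi)
    (u ^+ (a - 1) * dl u ^+ s / critical_denom xi u ^+ 2 *
     ((s%:R - xi) * ((b + s)%:R - xi) * u ^+ h - (xi ^+ 2 + a%:R * xi))).
Proof.
move=> xi0 xis u01; have /andP[u0 u1] := u01.
have d0 : dl u != 0 by rewrite gt_eqF // delta_gt0.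
have B0 := lt0r_neq0 (critical_denom_gt0 xi0 xis u01).
have BD : is_derive u 1 (critical_denom xi) _ :=
  derD (derC u xi) (derCM (s%:R - xi) (derX h (is_derive_id u 1))).
have GD : is_derive u 1 (critical_gap xi) _ := derB (kernel_tail_derive b a_gt0 s_gt0 u01)
  (derM (derM (derX a (is_derive_id u 1)) (delta_pow_derive b a_gt0 s_gt0 u01))
    (derV B0 BD)).
apply: (is_derive_eq GD).
have U1 : 1 - u ^+ h != 0 by rewrite -delta_expn // expf_neq0.
have abE : dl u ^+ (a + b) = (1 - u ^+ h) / dl u ^+ s.
  by rewrite -delta_expn // (exprD _ (a + b) s) mulfK ?expf_neq0.
rewrite /kernel_density abE /critical_denom.
move: B0; rewrite /critical_denom.
have -> : u ^+ a = u * u ^+ (a - 1) by rewrite subn1 -exprS prednK.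
have hE : u ^+ h = u * u ^+ h.-1 by rewrite -exprS prednK.
have -> : a.-1 = (a - 1)%N by rewrite subn1.
rewrite hE in U1 *.
move: (u ^+ (a - 1)) (u ^+ h.-1) (dl u ^+ s) (expf_neq0 s d0) U1 => A H V V0 U1 B0.
rewrite /urn_h !natrD.
by field; rewrite V0 U1 B0.
Qed.

(** Near 0 the tail stays positive, while the subtracted term is at most u / xi. *)
Lemma critical_gap_near0 (xi v : R) : 0 < xi -> xi < s%:R -> 0 < v < 1 ->
  exists2 u, 0 < u < v & 0 < critical_gap xi u.
Proof.
move=> xi0 xis v01; have /andP[v0 v1] := v01.
have T0 := kernel_tail_gt0 v01.
pose u := Num.min (v / 2) (xi * tail v / 2).
have u0 : 0 < u by rewrite lt_min !divr_gt0 ?mulr_gt0.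
have uv : u <= v / 2 by rewrite ge_min lexx.
have ux : u <= xi * tail v / 2 by rewrite ge_min lexx orbT.
have u01 : 0 < u < 1 by lra.
exists u; first by lra.
have Tu : tail v < tail u by apply: kernel_tail_lt => //; lra.
rewrite subr_gt0; apply: le_lt_trans Tu.
rewrite ler_pdivrMr ?critical_denom_gt0 //.
apply: (@le_trans _ _ u).
  have d1 : dl u ^+ s <= 1.
    by apply: exprn_ile1; apply/ltW; [exact: delta_gt0 | exact: delta_lt1].
  apply: (@le_trans _ _ (u ^+ a)); first by rewrite ler_piMr // exprn_ge0 // ltW.
  have /andP[_ u1] := u01.
  by rewrite -{2}[u]expr1; apply: ler_wiXn2l => //; apply: ltW.
apply: (@le_trans _ _ (tail v * xi)).
  by apply: le_trans ux _; have := mulr_gt0 xi0 T0; rewrite mulrC; lra.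
by rewrite ler_pM2l // critical_denom_ge.
Qed.

(** If the gap were nonnegative somewhere on a stretch where it increases up to 1,
    it would stay away from 0 near 1, where the tail vanishes. *)
Lemma critical_gap_lt0 (xi u : R) : 0 < xi -> xi < s%:R -> 0 < u < 1 ->
    (forall x y : R, u <= x -> x < y -> y < 1 -> critical_gap xi x < critical_gap xi y) ->
  critical_gap xi u < 0.
Proof.
move=> xi0 xis u01 incr; have /andP[u0 u1] := u01.
pose v := (u + 1) / 2; have uv : u < v by rewrite /v; lra.
have v1 : v < 1 by rewrite /v; lra.
have v01 : 0 < v < 1 by rewrite v1 (lt_trans u0).
apply: lt_le_trans (incr _ _ (lexx u) uv v1) _; rewrite leNgt; apply/negP => gv.
have v0 : 0 < v by case/andP: v01.
have [x [/andP[vx x1] Tx]] := kernel_tail_small v01 gv.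
have x01 : 0 < x < 1 by rewrite x1 (lt_trans v0).
have := lt_trans Tx (incr _ _ (ltW uv) vx x1); apply/negP; rewrite -leNgt.
rewrite gerBl divr_ge0 ?mulr_ge0 ?exprn_ge0 ?(ltW (delta_gt0 _ _ _ x01)) //.
  by case/andP: x01 => /ltW.
by apply: ltW; apply: critical_denom_gt0.
Qed.

(** By [critical_gap_derive] the gap decreases on (0, us] and increases on [us, 1), where
    us^h = alpha / rho; the bound on [xi] is exactly the condition alpha < rho.  Being
    positive near 0 and negative on [us, 1), it has one zero, on (0, us). *)
Lemma critical_gap_root (xi : R) : 0 < xi ->
    xi < s%:R * ((s + b)%:R / (s + h)%:R) ->
  exists l : R, [/\ 0 < l < 1, critical_gap xi l = 0,
    forall u : R, 0 < u < l -> 0 < critical_gap xi u &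
    forall u : R, l < u < 1 -> critical_gap xi u < 0].
Proof.
move=> xi0; rewrite mulrA ltr_pdivlMr ?ltr0n ?addn_gt0 ?s_gt0 // => xi_lt.
have a0 : 0 < a%:R :> R by rewrite ltr0n.
have b0 : 0 < b%:R :> R by rewrite ltr0n.
rewrite /urn_h !natrD in xi_lt.
have ss0 := mulr_gt0 s0 s0; have sa0 := mulr_gt0 s0 a0.
have xis : xi < s%:R.
  have D0 : 0 < s%:R + (a%:R + b%:R + s%:R) :> R by rewrite !addr_gt0.
  by rewrite -(ltr_pM2r D0); apply: lt_trans xi_lt _; lra.
pose alpha := xi ^+ 2 + a%:R * xi; pose rho := (s%:R - xi) * ((b + s)%:R - xi).
have alpha0 : 0 < alpha by rewrite addr_gt0 ?exprn_gt0 // mulr_gt0.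
have ar : alpha < rho by rewrite /rho /alpha natrD; lra.
have rho0 := lt_trans alpha0 ar.
have q01 : 0 < alpha / rho < 1 by rewrite divr_gt0 //= ltr_pdivrMr // mul1r.
pose us := (alpha / rho) `^ h%:R^-1.
have us0 : 0 < us by rewrite powR_gt0 //; case/andP: q01.
have usE : us ^+ h = alpha / rho.
  rewrite -powR_mulrn ?powR_ge0 // -powRrM mulVf ?pnatr_eq0 -?lt0n //.
  by rewrite powRr1 // ltW //; case/andP: q01.
have us1 : us < 1.
  rewrite -(@ltr_pXn2r _ h) ?nnegrE ?(ltW us0) // usE expr1n.
  by case/andP: q01.
have pref (u : R) : 0 < u < 1 -> 0 < u ^+ (a - 1) * dl u ^+ s / critical_denom xi u ^+ 2.
  move=> u01; rewrite divr_gt0 ?mulr_gt0 ?exprn_gt0 ?delta_gt0 ?critical_denom_gt0 //.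
  by case/andP: u01.
have decr (x y : R) : 0 < x -> x < y -> y <= us -> critical_gap xi y < critical_gap xi x.
  move=> x0 xy yus; apply: is_derive_lt0_gt => //.
    move=> t /andP[xt ty]; apply: critical_gap_derive => //.
    by rewrite (lt_le_trans x0) //= (le_lt_trans ty) // (le_lt_trans yus).
  move=> t /andP[xt ty]; have t0 := lt_trans x0 xt; have tus := lt_le_trans ty yus.
  rewrite pmulr_rlt0 ?pref ?t0 ?(lt_trans tus) // subr_lt0 -/alpha -/rho.
  by rewrite mulrC -ltr_pdivlMr // -usE ltr_pXn2r ?nnegrE ?(ltW us0) ?(ltW t0).
have incr (x y : R) : us <= x -> x < y -> y < 1 -> critical_gap xi x < critical_gap xi y.
  move=> usx xy y1; have x0 := lt_le_trans us0 usx.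
  have in01 (t : R) : x <= t <= y -> 0 < t < 1.
    by move=> /andP[xt ty]; rewrite (lt_le_trans x0) //= (le_lt_trans ty).
  apply: is_derive_gt0_lt _ xy _.
    by move=> t /in01 t01; exact: (critical_gap_derive xi0 xis t01).
  move=> t /andP[xt ty].
  rewrite pmulr_rgt0 ?pref ?in01 ?(ltW xt) ?(ltW ty) // subr_gt0 -/alpha -/rho.
  rewrite mulrC -ltr_pdivrMr // -usE ltr_pXn2r ?nnegrE ?(ltW us0) ?(le_lt_trans usx) //.
  by rewrite ltW // (lt_trans x0).
have neg (u : R) : us <= u -> u < 1 -> critical_gap xi u < 0.
  move=> usu u1; apply: critical_gap_lt0 => //; first by rewrite u1 (lt_le_trans us0).
  by move=> x y ux; apply: incr; apply: le_trans ux.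
have [|u0 /andP[u00 u0us] gu0] := @critical_gap_near0 xi us xi0 xis; first by rewrite us0.
have [||l] := @IVT R (critical_gap xi) u0 us 0 (ltW u0us).
- apply: continuous_in_subspaceT => x; rewrite inE/= in_itv/= => /andP[ux xus].
  have x01 : 0 < x < 1 by rewrite (lt_le_trans u00) //= (le_lt_trans xus).
  exact: is_derive_continuous (critical_gap_derive xi0 xis x01).
- by rewrite ge_min le_max (ltW gu0) (ltW (neg _ (lexx _) us1)) orbT.
rewrite in_itv/= => /andP[u0l lus] gl.
have l0 := lt_le_trans u00 u0l.
exists l; split => //; first by rewrite l0 (le_lt_trans lus).
- by move=> u /andP[u_0 ul]; rewrite -gl; apply: decr.
- move=> u /andP[lu u1]; have [uus|/ltW usu] := leP u us; last exact: neg.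
  by rewrite -gl; apply: decr.
Qed.

Lemma rate_base_derive (xi u : R) : 0 < xi -> xi < s%:R -> 0 < u < 1 ->
  is_derive u 1 (fun y => y `^ xi * K y)
    (u `^ (xi - 1) * K u *
     (critical_denom xi u * critical_gap xi u / (dl u ^+ s * dl u ^+ h * K u))).
Proof.
move=> xi0 xis u01; have /andP[u0 u1] := u01.
have pw : is_derive u 1 (@powR R ^~ xi) (xi * u `^ (xi - 1)) by apply: is_derive1_powR.
have D : is_derive u 1 (fun y => y `^ xi * K y) _ := derM pw (urn_K_derive u01).
apply: (is_derive_eq D); rewrite -urn_K_log_derive // derive1E.
rewrite (@derive_val _ _ _ _ _ _ _ (urn_K_derive u01)).
have -> : u `^ xi = u `^ (xi - 1) * u by rewrite mulrC mulr_powRB1 // ltW.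
have K0 := lt0r_neq0 (urn_K_gt0 u01).
have d0 : dl u ^+ h != 0 by rewrite expf_neq0 // gt_eqF // delta_gt0.
by field; rewrite d0 K0.
Qed.

Lemma rate_base_lt (xi l u : R) : 0 < xi -> xi < s%:R -> 0 < l < 1 ->
    (forall u : R, 0 < u < l -> 0 < critical_gap xi u) ->
    (forall u : R, l < u < 1 -> critical_gap xi u < 0) ->
  0 < u < 1 -> u != l -> u `^ xi * K u < l `^ xi * K l.
Proof.
move=> xi0 xis l01 pos neg u01 ul.
have pref (x : R) : 0 < x < 1 -> 0 < x `^ (xi - 1) * K x *
    (critical_denom xi x / (dl x ^+ s * dl x ^+ h * K x)).
  move=> x01; have /andP[x0 _] := x01.
  apply: mulr_gt0; first by rewrite mulr_gt0 ?powR_gt0 ?urn_K_gt0.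
  apply: divr_gt0; first exact: critical_denom_gt0.
  by apply: mulr_gt0; [rewrite mulr_gt0 ?exprn_gt0 ?delta_gt0 | exact: urn_K_gt0].
have DE (x : R) : 0 < x < 1 -> is_derive x 1 (fun y => y `^ xi * K y)
    (x `^ (xi - 1) * K x * (critical_denom xi x / (dl x ^+ s * dl x ^+ h * K x)) *
     critical_gap xi x).
  by move=> x01; apply: (is_derive_eq (rate_base_derive xi0 xis x01)); ring.
have /andP[l0 l1] := l01; have /andP[u0 u1] := u01.
have [lt_ul|lt_lu|E] := ltgtP u l; last by rewrite E eqxx in ul.
  apply: (is_derive_gt0_lt (f := fun y => y `^ xi * K y)) lt_ul _.
    by move=> x /andP[ux xl]; apply: DE; rewrite (lt_le_trans u0) //= (le_lt_trans xl).
  move=> x /andP[ux xl]; have x0 := lt_trans u0 ux.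
  by rewrite mulr_gt0 ?pref ?pos ?x0 //= (lt_trans xl).
apply: (is_derive_lt0_gt (f := fun y => y `^ xi * K y)) lt_lu _.
  by move=> x /andP[lx xu]; apply: DE; rewrite (lt_le_trans l0) //= (le_lt_trans xu).
move=> x /andP[lx xu]; have x1 := lt_trans xu u1.
by rewrite pmulr_rlt0 ?pref ?neg ?lx // x1 (lt_trans l0).
Qed.

End Optimum.

(** * Exponential growth of the weighted histories *)

Section GrowthRate.
Variables (R : realType) (a b s p q : nat).
Hypotheses (a_gt0 : (0 < a)%N) (b_gt0 : (0 < b)%N) (s_gt0 : (0 < s)%N).
Hypotheses (apE : (a * p = b + s)%N) (bqE : (b * q = a + s)%N).

Notation h := (urn_h a b s).
Notation dl := (@urn_delta R a b s).
Notation f := (@kernel_density R a b s).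
Notation tail := (@kernel_tail R a b s).
Notation K := (@urn_K R a b s).
Notation hist := (@hist R a b p q).

(** The solution of X' = a Y^q, Y' = b X^p, with respect to the clock of speed
    [kernel_density], on the level set Y^(h/b) - X^(h/a) = 1. *)
Definition flowX (v : R) : R := (v / dl v) ^+ a.
Definition flowY (v : R) : R := (dl v)^-1 ^+ b.

Lemma flowX_gt0 (v : R) : 0 < v < 1 -> 0 < flowX v.
Proof. by move=> v01; rewrite exprn_gt0 // divr_gt0 ?delta_gt0 //; case/andP: v01. Qed.

Lemma flowY_gt0 (v : R) : 0 < v < 1 -> 0 < flowY v.
Proof. by move=> v01; rewrite exprn_gt0 // invr_gt0 delta_gt0. Qed.

Let ratio_derive (v : R) : 0 < v < 1 ->
  is_derive v 1 (fun y => y / dl y) (dl v * dl v ^+ h)^-1.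
Proof.
move=> v01; have d0 : dl v != 0 by rewrite gt_eqF // delta_gt0.
apply: (is_derive_eq (derM (is_derive_id v 1) (derV d0 (delta_derive b s a_gt0 v01)))).
have hE : v * v ^+ h.-1 = 1 - dl v ^+ h.
  by rewrite -exprS prednK ?delta_expn ?subKr // /urn_h !addn_gt0 a_gt0.
apply: (@etrans _ _ ((dl v)^-1 + v * v ^+ h.-1 / (dl v * dl v ^+ h))).
  by field; rewrite d0 expf_neq0.
by rewrite hE; field; rewrite d0 expf_neq0.
Qed.

Let flowX_derive (v : R) : 0 < v < 1 -> is_derive v 1 flowX (f v * (a%:R * flowY v ^+ q)).
Proof.
move=> v01; have d0 : dl v != 0 by rewrite gt_eqF // delta_gt0.
apply: (is_derive_eq (derX a (ratio_derive v01))).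
rewrite /kernel_density /flowY -exprM bqE !exprVn expr_div_n -subn1.
have hE : dl v ^+ h = dl v ^+ (a + b) * dl v ^+ s by rewrite -exprD.
have aE : dl v ^+ (a + s) = dl v * dl v ^+ (a - 1) * dl v ^+ s.
  by rewrite exprD subn1 -exprS prednK.
by rewrite hE aE; field; rewrite d0 !expf_neq0.
Qed.

Let flowY_derive (v : R) : 0 < v < 1 -> is_derive v 1 flowY (f v * (b%:R * flowX v ^+ p)).
Proof.
move=> v01; have d0 : dl v != 0 by rewrite gt_eqF // delta_gt0.
have -> : flowY = (fun y => (dl y ^+ b)^-1) by apply/funext => y; rewrite /flowY exprVn.
apply: (is_derive_eq (inv_delta_derive b s a_gt0 b v01)).
rewrite /kernel_density /flowX -exprM apE expr_div_n.
have -> : (h.-1 = (a - 1) + (b + s))%N by rewrite /urn_h subn1 -addnA -!subn1 addnBAC.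
rewrite /urn_h !exprD.
by field; rewrite !expf_neq0.
Qed.

Let orbit n i j (v : R) := hist (mon (flowX v) (flowY v)) n i j.

Lemma hist_orbit_derive n i j (v : R) : 0 < v < 1 ->
  is_derive v 1 (orbit n i j) (f v * orbit n.+1 i j v).
Proof.
move=> v01; elim: n i j => [|n IHn] i j.
  apply: (is_derive_eq (derM (derX i (flowX_derive v01)) (derX j (flowY_derive v01)))).
  by rewrite /orbit /= /mon !exprD !natrM; ring.
have D : is_derive v 1 (orbit n.+1 i j) _ :=
  derD (derCM (a * i)%:R (IHn i.-1 (j + q)%N)) (derCM (b * j)%:R (IHn (i + p)%N j.-1)).
apply: (is_derive_eq D).
rewrite -[orbit n.+2 i j v]/((a * i)%:R * orbit n.+1 i.-1 (j + q) v +
  (b * j)%:R * orbit n.+1 (i + p) j.-1 v).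
by move: (orbit n.+1) => o; ring.
Qed.

(** By homogeneity, the polynomial in u^a which generates the histories is the orbit up
    to a power of delta. *)
Lemma hist_orbitE n i j (v : R) : 0 < v < 1 ->
  hist (mon (v ^+ a) 1) n i j = dl v ^+ (a * i + b * j + s * n) * orbit n i j v.
Proof.
move=> v01; have d0 : dl v != 0 by rewrite gt_eqF // delta_gt0.
rewrite /orbit -(hist_homogeneous (dl v) _ n i j apE bqE).
have -> // : mon (v ^+ a) 1 =
    (fun i j => dl v ^+ (a * i + b * j) * mon (flowX v) (flowY v) i j).
apply/funext => i'; apply/funext => j'.
rewrite /mon /flowX /flowY -!exprM expr1n expr_div_n exprD !exprVn.
by field; rewrite !expf_neq0.
Qed.

(** The Taylor coefficients of the orbit at [u] are of order at most
    (tail u - tail v)^-n, and tail v is as small as desired. *)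
Lemma hist_growth_upper (u sigma : R) i j : 0 < u < 1 -> (K u)^-1 < sigma ->
  exists2 C, 0 < C & forall n, hist (mon (u ^+ a) 1) n i j / n`!%:R <= C * sigma ^+ n.
Proof.
move=> u01 Ks; have /andP[u0 u1] := u01.
have K0 := urn_K_gt0 b a_gt0 s_gt0 u01; have d0 := delta_gt0 b s a_gt0 u01.
have sig0 : 0 < sigma by apply: lt_trans Ks; rewrite invr_gt0.
have T0 : dl u ^+ s / sigma < tail u.
  rewrite ltr_pdivrMr // mulrC -ltr_pdivrMr ?kernel_tail_gt0 //.
  by move: Ks; rewrite urn_KE invfM invrK.
have [v [/andP[uv v1] Tv]] : exists v, u < v < 1 /\ tail v < tail u - dl u ^+ s / sigma.
  by apply: kernel_tail_small => //; rewrite subr_gt0.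
have v01 : 0 < v < 1 by rewrite v1 (lt_trans u0).
have in01 (x : R) : u <= x < 1 -> 0 < x < 1 by move=> /andP[ux ->]; rewrite (lt_le_trans u0).
have Z0 : 0 < tail u - tail v by rewrite subr_gt0 kernel_tail_lt.
have le_Z : dl u ^+ s / (tail u - tail v) <= sigma.
  by rewrite ler_pdivrMr // mulrC -ler_pdivrMr //; lra.
pose C := dl u ^+ (a * i + b * j) * orbit 0 i j v.
have C0 : 0 < C.
  apply: mulr_gt0; first by rewrite exprn_gt0.
  by apply: mulr_gt0; rewrite exprn_gt0 ?flowX_gt0 ?flowY_gt0.
exists C => // n; rewrite hist_orbitE // exprD exprM.
have coeff_le : orbit n i j u * (tail u - tail v) ^+ n / n`!%:R <= orbit 0 i j v.
  apply: (@taylor_coeff_le R u f (fun x => tail u - tail x) (fun n => orbit n i j)).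
  - by move=> x /in01 x01; exact: kernel_density_gt0.
  - move=> x /in01 x01.
    apply: (is_derive_eq (derB (derC x (tail u)) (kernel_tail_derive b a_gt0 s_gt0 x01))).
    by rewrite sub0r opprK.
  - by rewrite subrr.
  - by move=> m x /in01 x01; apply: hist_mon_ge0; rewrite ltW ?flowX_gt0 ?flowY_gt0.
  - by move=> m x /in01 x01; apply: hist_orbit_derive.
  - by rewrite v1 ltW.
apply: (@le_trans _ _ (C * (dl u ^+ s / (tail u - tail v)) ^+ n)); last first.
  by rewrite ler_pM2l // lerXn2r // nnegrE ?divr_ge0 ?exprn_ge0 ?ltW.
rewrite /C; move: coeff_le; move: (orbit 0 i j v) => g0 coeff_le.
rewrite expr_div_n -!mulrA ler_pM2l ?exprn_gt0 //.
rewrite [leRHS]mulrCA ler_pM2l ?exprn_gt0 // ler_pdivlMr ?exprn_gt0 //.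
by rewrite mulrAC.
Qed.

Let fact_gt0R n : 0 < n`!%:R :> R. Proof. by rewrite ltr0n fact_gt0. Qed.

Let tail_gt0 (u : R) : 0 < u < 1 -> 0 < tail u.
Proof. exact: kernel_tail_gt0. Qed.

Lemma flowX_unbounded (u M : R) : 0 < u < 1 -> exists2 v, u < v < 1 & M < flowX v.
Proof.
move=> u01; have /andP[u0 u1] := u01.
pose M' := Num.max 1 M; have M0 : 0 < M' by rewrite lt_max ltr01.
have eps0 : 0 < u / M' / 2 by rewrite !divr_gt0.
have [z /andP[z0 z1] zP] := delta_small b s a_gt0 eps0.
pose v := Num.max z ((u + 1) / 2).
have v1 : v < 1 by rewrite gt_max z1; lra.
have uv : u < v by rewrite lt_max; apply/orP; right; lra.
have v01 : 0 < v < 1 by rewrite v1 (lt_trans u0).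
have dv : dl v < u / M' / 2 by apply: zP; rewrite v1 le_max lexx.
exists v; first by rewrite uv.
have dM : dl v * M' < u / 2 by rewrite -ltr_pdivlMr // mulrAC.
have d0 := delta_gt0 b s a_gt0 v01.
have ratio_gt : M' < v / dl v by rewrite ltr_pdivlMr // mulrC; lra.
have ratio1 : 1 <= v / dl v by rewrite (le_trans _ (ltW ratio_gt)) // le_max lexx.
apply: (@le_lt_trans _ _ M'); first by rewrite le_max lexx orbT.
by apply: lt_le_trans ratio_gt _; rewrite -[leLHS]expr1; apply: ler_weXn2l.
Qed.


Let hist_posX (u : R) : 0 < u < 1 -> 0 <= flowX u /\ 0 <= flowY u.
Proof. by move=> u01; rewrite !ltW ?flowX_gt0 ?flowY_gt0. Qed.

Let p_gt0 : (0 < p)%N.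
Proof. by case: p apE => // /esym/eqP; rewrite muln0 addn_eq0 !gtn_eqF. Qed.

Let q_gt0 : (0 < q)%N.
Proof. by case: q bqE => // /esym/eqP; rewrite muln0 addn_eq0 !gtn_eqF. Qed.

(** One bunch of the first color yields p q bunches of this color, via q bunches of
    the second. *)
Let pq_gt1 : (1 < p * q)%N.
Proof.
rewrite -(ltn_pmul2l (_ : (0 < a * b)%N)); last by rewrite muln_gt0 a_gt0.
by rewrite muln1 mulnACA apE bqE mulnC ltn_mul // -addn1 leq_add.
Qed.

Let hist_gt0 X Y n i j : 0 < X -> 0 < Y -> (0 < i + j)%N -> 0 < hist (mon X Y) n i j.
Proof.
move=> X0 Y0; elim: n i j => [|n IHn] i j ij; first by rewrite mulr_gt0 ?exprn_gt0.
have h0 k l : 0 <= hist (mon X Y) n k l by apply: hist_mon_ge0; exact: ltW.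
rewrite /=; case: i ij => [|i] ij.
  rewrite muln0 mul0r add0r; rewrite add0n in ij.
  by rewrite mulr_gt0 ?ltr0n ?muln_gt0 ?b_gt0 // IHn // addn_gt0 add0n p_gt0.
rewrite ltr_pwDl ?mulr_ge0 // mulr_gt0 ?ltr0n ?muln_gt0 ?a_gt0 // IHn //.
by rewrite !addn_gt0 q_gt0 !orbT.
Qed.

(** The [j] bunches of the second color are drawn one after the other. *)
Let hist_convert X Y n i j : 0 <= X -> 0 <= Y ->
  b%:R ^+ j * hist (mon X Y) n (i + p * j) 0 <= hist (mon X Y) (n + j) i j.
Proof.
move=> X0 Y0; have h0 m k l : 0 <= hist (mon X Y) m k l by apply: hist_mon_ge0.
elim: j i => [|j IHj] i; first by rewrite expr0 mul1r muln0 !addn0.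
rewrite addnS /=; apply: (@le_trans _ _ (b%:R * hist (mon X Y) (n + j) (i + p) j)).
  rewrite exprS -mulrA ler_wpM2l // (le_trans _ (IHj _)) //.
  by rewrite mulnS addnA.
apply: (@le_trans _ _ ((b * j.+1)%:R * hist (mon X Y) (n + j) (i + p) j)).
  by rewrite ler_wpM2r // ler_nat leq_pmulr.
by rewrite lerDr mulr_ge0.
Qed.

(** After q + 1 draws, one bunch of the first color has become p q >= 2 of them; two of
    these start independent sub-urns, and the others are left alone. *)
Let hist_regenerate X Y k l : 0 <= X -> 0 <= Y ->
  (a%:R * b%:R ^+ q * X ^+ (p * q - 2)) * ('C(k + l, k)%:R *
    hist (mon X Y) k 1 0 * hist (mon X Y) l 1 0) <=
  hist (mon X Y) (k + l + q.+1) 1 0.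
Proof.
move=> X0 Y0; have h0 m i j : 0 <= hist (mon X Y) m i j by apply: hist_mon_ge0.
rewrite addnS /= muln0 mul0r addr0 muln1 add0n -!mulrA ler_wpM2l //.
apply: le_trans (hist_convert _ _ _ X0 Y0); rewrite add0n ler_wpM2l ?exprn_ge0 //.
have := @hist_monM R a b p q X Y 0 (k + l) (p * q - 2) 0 2 0 X0 Y0.
rewrite add0n bin0 mul1r subnK // addn0; apply: le_trans.
rewrite -[hist (mon X Y) 0 _ 0]/(X ^+ (p * q - 2) * 1) mulr1.
rewrite ler_wpM2l ?exprn_ge0 // mulrA; exact: (@hist_monM R a b p q X Y k l 1 0 1 0 X0 Y0).
Qed.

Let fact_addn_le k m : ((k + m)`! <= k`! * (k + m) ^ m)%N.
Proof.
elim: m => [|m IHm]; first by rewrite addn0 muln1.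
rewrite addnS factS expnS mulnCA leq_mul2l /= (leq_trans IHm) // leq_mul2l.
by apply/orP; right; case: m {IHm} => [//|m]; rewrite leq_exp2r.
Qed.

Let c (u : R) n := orbit n 1 0 u / n`!%:R.

Let c_gt0 (u : R) n : 0 < u < 1 -> 0 < c u n.
Proof. by move=> u01; rewrite divr_gt0 // hist_gt0 ?flowX_gt0 ?flowY_gt0. Qed.

(** Otherwise the orbit of the first color would stay bounded up to parameter 1, where it
    blows up. *)
Let c_often (u rho : R) : 0 < u < 1 -> 0 < rho -> rho < (tail u)^-1 ->
  forall N0, exists2 N, (N0 <= N)%N & rho ^+ N <= c u N.
Proof.
move=> u01 rho0 rhoI N0; apply: contrapT => noN.
have T0 := tail_gt0 u01; have /andP[u0 u1] := u01.
have rT : rho * tail u < 1 by rewrite -ltr_pdivlMr // mul1r.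
have [|eps eps0 epsP] := @finite_positive_min R (fun n => rho ^+ n / c u n) N0.
  by move=> n; rewrite divr_gt0 ?exprn_gt0 ?c_gt0.
have [M0 M1] : 0 < Num.max 1 eps^-1 /\ 1 <= Num.max 1 eps^-1.
  by rewrite lt_max ltr01 le_max lexx.
have in01 (x : R) : u <= x < 1 -> 0 < x < 1 by move=> /andP[ux ->]; rewrite (lt_le_trans u0).
have bounded := @absolutely_monotone_bounded R u f (fun x => tail u - tail x)
  (fun n => orbit n 1 0) _ _ _ _ _ (tail u) (Num.max 1 eps^-1) rho _ (ltW rho0) rT (ltW M0) _.
have [v /andP[uv v1]] := flowX_unbounded (Num.max 1 eps^-1 / (1 - rho * tail u)) u01.
apply/negP; rewrite -leNgt.
have -> : flowX v = orbit 0 1 0 v by rewrite /orbit /= /mon expr0 mulr1 expr1.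
apply: bounded; last by rewrite uv.
- by move=> x /in01 x01; exact: kernel_density_gt0.
- move=> x /in01 x01.
  apply: (is_derive_eq (derB (derC x (tail u)) (kernel_tail_derive b a_gt0 s_gt0 x01))).
  by rewrite sub0r opprK.
- by rewrite subrr.
- by move=> m x /in01 x01; apply: hist_mon_ge0; rewrite ltW ?flowX_gt0 ?flowY_gt0.
- by move=> m x /in01 x01; apply: hist_orbit_derive.
- by move=> x /in01 x01; rewrite gerBl ltW // tail_gt0.
- move=> n; rewrite -/(c u n); have [nN|Nn] := ltnP n N0.
    have := epsP _ nN; rewrite ler_pdivlMr ?c_gt0 // mulrC -ler_pdivlMr // => /le_trans; apply.
    by rewrite mulrC ler_wpM2r ?exprn_ge0 ?(ltW rho0) // le_max lexx orbT.
  apply: (@le_trans _ _ (rho ^+ n)); last by rewrite ler_peMl ?exprn_ge0 // ltW.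
  by rewrite leNgt; apply/negP => /ltW lt_c; apply: noN; exists n.
Qed.

Let c_lower (u sigma : R) : 0 < u < 1 -> 0 < sigma -> sigma < (tail u)^-1 ->
  exists2 C, 0 < C & forall n, C * sigma ^+ n <= c u n.
Proof.
move=> u01 sig0 sigI; have [X0 Y0] := hist_posX u01.
pose rho := (sigma + (tail u)^-1) / 2.
have rho1 : sigma < rho by rewrite /rho; lra.
have rho2 : rho < (tail u)^-1 by rewrite /rho; lra.
have kap0 : 0 < a%:R * b%:R ^+ q * flowX u ^+ (p * q - 2).
  apply: mulr_gt0; last by rewrite exprn_gt0 ?flowX_gt0.
  by apply: mulr_gt0; rewrite ?exprn_gt0 // ltr0n.
apply: (@supermultiplicative_lower R (c u) q.+1 _ _ kap0 _ rho); first 1 last.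
- move=> k l; rewrite /c.
  have reg := @hist_regenerate (flowX u) (flowY u) k l X0 Y0.
  rewrite [leRHS]mulrA ler_pdivlMr //.
  set kap := _ * flowX u ^+ _ in reg *.
  have fl : (k + l + q.+1)`!%:R <= (k + l)`!%:R * (k + l + q.+1)%:R ^+ q.+1 :> R.
    by rewrite -natrX -natrM ler_nat fact_addn_le.
  have lhs0 : 0 <= kap * (orbit k 1 0 u / k`!%:R) * (orbit l 1 0 u / l`!%:R).
    by apply: mulr_ge0; [apply: mulr_ge0; first exact: ltW |]; exact: ltW (c_gt0 _ u01).
  apply: le_trans (ler_wpM2l lhs0 fl) _.
  rewrite [leLHS]mulrA [leLHS]mulrC ler_wpM2l ?exprn_ge0 //; apply: le_trans reg.
  have binE : 'C(k + l, k)%:R = (k + l)`!%:R / (k`!%:R * l`!%:R) :> R.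
    have kl0 : k`!%:R * l`!%:R != 0 :> R by rewrite gt_eqF // mulr_gt0.
    apply: (canRL (mulfK kl0)).
    by rewrite -(bin_fact (leq_addr l k)) addKn !natrM.
  rewrite binE -/(orbit k 1 0 u) -/(orbit l 1 0 u) le_eqVlt; apply/orP; left; apply/eqP.
  by field; rewrite !gt_eqF.
- by rewrite sig0.
- by apply: c_often => //; exact: lt_trans rho1.
- by move=> n; exact: c_gt0.
Qed.

(** An urn with a bunch of the first color does at least as well as this bunch alone; an urn
    that has none gets one at the first draw, at the price of a factor n. *)
Lemma hist_growth_lower (u sigma : R) i j : (0 < i + j)%N ->
    0 < u < 1 -> 0 < sigma -> sigma < (K u)^-1 ->
  exists2 C, 0 < C & forall n, C * sigma ^+ n <= hist (mon (u ^+ a) 1) n i j / n`!%:R.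
Proof.
move=> ij u01 sig0 sigK; have /andP[u0 u1] := u01.
have ua0 : 0 < u ^+ a by rewrite exprn_gt0.
have d0 := delta_gt0 b s a_gt0 u01; have ds0 : 0 < dl u ^+ s by rewrite exprn_gt0.
have base tau : 0 < tau -> tau < (K u)^-1 -> exists2 C, 0 < C &
    forall n, C * tau ^+ n <= hist (mon (u ^+ a) 1) n 1 0 / n`!%:R.
  move=> tau0 tauK; have [||C C0 CP] := @c_lower u (tau / dl u ^+ s) u01.
  - by rewrite divr_gt0.
  - by rewrite ltr_pdivrMr //; move: tauK; rewrite urn_KE invfM invrK mulrC.
  exists (dl u ^+ (a * 1 + b * 0) * C) => [|n]; first by rewrite mulr_gt0 ?exprn_gt0.
  rewrite hist_orbitE // [dl u ^+ (_ + s * n)]exprD -!mulrA ler_wpM2l ?exprn_ge0 ?(ltW d0) //.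
  have := CP n; rewrite expr_div_n (mulrA C) ler_pdivrMr ?exprn_gt0 // exprM.
  by move=> /le_trans; apply; rewrite mulrC mulrA.
have h0 n k l : 0 <= hist (mon (u ^+ a) 1) n k l by apply: hist_mon_ge0 => //; exact: ltW.
case: i ij => [|i] ij; last first.
  have [C C0 CP] := base sigma sig0 sigK.
  have W0 : 0 < mon (u ^+ a) 1 i j by rewrite mulr_gt0 ?exprn_gt0.
  exists (C * mon (u ^+ a) 1 i j) => [|n]; first by rewrite mulr_gt0.
  have := @hist_monM R a b p q (u ^+ a) 1 n 0 1 0 i j (ltW ua0) ler01.
  rewrite addn0 binn mul1r add1n add0n -[hist _ 0 i j]/(mon (u ^+ a) 1 i j) => le_h.
  rewrite mulrAC ler_pdivlMr //; apply: le_trans le_h.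
  rewrite [leLHS]mulrAC; apply: ler_wpM2r; first exact: ltW.
  by rewrite -ler_pdivlMr.
case: j ij => [//|j] _.
pose tau := (sigma + (K u)^-1) / 2.
have st : sigma < tau by rewrite /tau; lra.
have tK : tau < (K u)^-1 by rewrite /tau; lra.
have tau0 := lt_trans sig0 st.
have [C C0 CP] := base tau tau0 tK.
have W0 : 0 < mon (u ^+ a) 1 p.-1 j by rewrite mulr_gt0 ?exprn_gt0.
have [|B B0 BP] := @polynomial_le_geometric R 1 sigma tau; first by rewrite sig0.
apply: (@eventual_lower_bound R _ sigma 1 (b%:R * C * mon (u ^+ a) 1 p.-1 j / (B * tau))).
- by move=> n; rewrite divr_gt0 // hist_gt0.
- by [].
- apply: divr_gt0; last exact: mulr_gt0.
  by apply: mulr_gt0 => //; rewrite mulr_gt0 // ltr0n.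
case=> // n _.
have := @hist_monM R a b p q (u ^+ a) 1 n 0 1 0 p.-1 j (ltW ua0) ler01.
rewrite addn0 binn mul1r add1n prednK // add0n -[hist _ 0 _ j]/(mon (u ^+ a) 1 p.-1 j) => le_h.
have le_h' : b%:R * (hist (mon (u ^+ a) 1) n 1 0 * mon (u ^+ a) 1 p.-1 j) <=
    hist (mon (u ^+ a) 1) n.+1 0 j.+1.
  rewrite /= muln0 mul0r add0r add0n; apply: ler_pM => //; first by rewrite mulr_ge0 // ltW.
  by rewrite ler_nat leq_pmulr.
rewrite ler_pdivlMr //; apply: le_trans le_h'; rewrite factS natrM.
have CPn := CP n; rewrite ler_pdivlMr // in CPn.
have BPn := BP n.+1; rewrite expr1 in BPn.
have -> : b%:R * C * mon (u ^+ a) 1 p.-1 j / (B * tau) * sigma ^+ n.+1 * (n.+1%:R * n`!%:R) =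
    (b%:R * mon (u ^+ a) 1 p.-1 j) * (C * ((n.+1%:R * sigma ^+ n.+1) / (B * tau)) * n`!%:R).
  by ring.
have -> : b%:R * (hist (mon (u ^+ a) 1) n 1 0 * mon (u ^+ a) 1 p.-1 j) =
    (b%:R * mon (u ^+ a) 1 p.-1 j) * hist (mon (u ^+ a) 1) n 1 0 by ring.
apply: ler_wpM2l; first by rewrite mulr_ge0 // ltW.
apply: le_trans CPn; rewrite ler_wpM2r // ler_wpM2l ?(ltW C0) //.
rewrite ler_pdivrMr; last exact: mulr_gt0.
by apply: le_trans BPn _; rewrite exprSr mulrCA.
Qed.

End GrowthRate.

(** * The law of the urn *)

Section UrnLaw.
Variables (R : realType) (d : measure_display) (T : measurableType d).
Variables (P : probability T R) (a b s a0 b0 : nat) (D : nat -> T -> bool).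
Variables (p q : nat).
Hypotheses (a_gt0 : (0 < a)%N) (b_gt0 : (0 < b)%N).
Hypotheses (p_gt0 : (0 < p)%N) (q_gt0 : (0 < q)%N).
Hypotheses (apE : (a * p = b + s)%N) (bqE : (b * q = a + s)%N).
Hypothesis urnD : urn_draws P a b s a0 b0 D.

Notation st := (urn_state a b s a0 b0).

Let past (c : nat -> bool) n : set T := [set w | forall i, (i < n)%N -> D i w = c i].

Let update (c : nat -> bool) (n : nat) e : nat -> bool := fun i => if i == n then e else c i.

(** Induction on the number of coordinates, splitting on the value of the last one. *)
Lemma measurable_cylinder n (Q : (nat -> bool) -> Prop) :
    (forall c c', (forall i, (i < n)%N -> c i = c' i) -> Q c -> Q c') ->
  measurable [set w | Q (fun i => D i w)].
Proof.
elim: n Q => [|n IHn] Q Q_ext.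
  have [Qf|nQ] := pselect (Q (fun=> false)).
    have -> : [set w | Q (fun i => D i w)] = setT.
      by apply/seteqP; split => // w _ /=; apply: Q_ext Qf.
    exact: measurableT.
  have -> : [set w | Q (fun i => D i w)] = set0.
    by apply/seteqP; split => // w /= Qw; apply: nQ; apply: Q_ext Qw.
  exact: measurable0.
have Dn_meas e : measurable (D n @^-1` [set e]).
  by rewrite -[X in measurable X]setTI; apply: urnD.1.
have Q'_meas e : measurable [set w | Q (update (fun i => D i w) n e)].
  apply: (IHn (fun c => Q (update c n e))) => c c' cc'; apply: Q_ext => i.
  by rewrite /update ltnS leq_eqVlt; case: eqVneq => //= _; exact: cc'.
have -> : [set w | Q (fun i => D i w)] =
    (D n @^-1` [set true] `&` [set w | Q (update (fun i => D i w) n true)]) `|`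
    (D n @^-1` [set false] `&` [set w | Q (update (fun i => D i w) n false)]).
  have updE w : update (fun i => D i w) n (D n w) = fun i => D i w.
    by apply/funext => i; rewrite /update; case: eqP => [->|].
  apply/seteqP; split => w /=.
    by case E: (D n w) => Qw; [left | right]; rewrite -E updE.
  by case=> -[<-]; rewrite updE.
by apply: measurableU; apply: measurableI.
Qed.

Let urn_state_ext c c' n : (forall i, (i < n)%N -> c i = c' i) ->
  urn_state a b s a0 b0 c n = urn_state a b s a0 b0 c' n.
Proof.
elim: n => [//|n IHn] cc' /=.
by rewrite IHn ?cc' // => i /ltnW; exact: cc'.
Qed.

Let past_meas c n : measurable (past c n).
Proof.
apply: (@measurable_cylinder n (fun c' => forall i, (i < n)%N -> c' i = c i)).
by move=> c1 c2 c12 c1c i ni; rewrite -c12 // c1c.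
Qed.

Let event (A : int -> bool) n : set T := [set w | A (urn_X a b s a0 b0 D n w)].

Let event_meas A n : measurable (event A n).
Proof.
apply: (@measurable_cylinder n (fun c => A (first_count a b s a0 b0 c n))).
by move=> c c' cc'; rewrite /first_count (urn_state_ext cc').
Qed.

Let past_update c n e : past (update c n e) n.+1 = past c n `&` (D n @^-1` [set e]).
Proof.
apply/seteqP; split => w /=.
  move=> H; split; last by rewrite H // /update eqxx.
  by move=> i ni; rewrite H ?ltnS ?(ltnW ni) // /update ltn_eqF.
move=> [H <-] i; rewrite ltnS leq_eqVlt /update; case: eqVneq => [-> //|_] /=.
exact: H.
Qed.

Let mass (E : set T) : R := fine (P E).

Let massE E : measurable E -> P E = (mass E)%:E.
Proof. by move=> mE; rewrite fineK // fin_num_measure. Qed.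

Let mass_ge0 E : 0 <= mass E. Proof. exact: fine_ge0. Qed.

Let mass_split E F n : measurable E -> measurable F ->
  mass (E `&` F) = mass (E `&` (D n @^-1` [set true]) `&` F) +
                   mass (E `&` (D n @^-1` [set false]) `&` F).
Proof.
move=> mE mF.
have Dn_meas e : measurable (D n @^-1` [set e]).
  by rewrite -[X in measurable X]setTI; apply: urnD.1.
have mB e : measurable (E `&` (D n @^-1` [set e]) `&` F) by do !apply: measurableI.
have -> : E `&` F = (E `&` (D n @^-1` [set true]) `&` F) `|`
    (E `&` (D n @^-1` [set false]) `&` F).
  apply/seteqP; split => w /=.
    by case=> Ew Fw; case Dw : (D n w); [left | right].
  by case=> -[[]].
apply: EFin_inj; rewrite EFinD -!massE //; last exact: measurableU.
rewrite measureU //; apply/seteqP; split => // w [[[_ /= Dw] _] [[_ /= Dw'] _]].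
by rewrite Dw in Dw'.
Qed.

Let count_true c n :
  st (update c n true) n.+1 =
    ((st c n).1 - a%:Z, (st c n).2 + (a + s)%N%:Z).
Proof.
rewrite /= (@urn_state_ext (update c n true) c); last first.
  by move=> i ni; rewrite /update ltn_eqF.
by rewrite /update eqxx; case: urn_state.
Qed.

Let count_false c n :
  st (update c n false) n.+1 =
    ((st c n).1 + (b + s)%N%:Z, (st c n).2 - b%:Z).
Proof.
rewrite /= (@urn_state_ext (update c n false) c); last first.
  by move=> i ni; rewrite /update ltn_eqF.
by rewrite /update eqxx; case: urn_state.
Qed.

(** Multiplied out by the total, so that both colors have the same form. *)
Let mass_draw c n i j : (0 < i + j)%N ->
    urn_state a b s a0 b0 c n = ((a * i)%N%:Z, (b * j)%N%:Z) ->
  (a * i + b * j)%:R * mass (past (update c n true) n.+1) = (a * i)%:R * mass (past c n) /\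
  (a * i + b * j)%:R * mass (past (update c n false) n.+1) = (b * j)%:R * mass (past c n).
Proof.
move=> ij stE; have t0 : (a * i + b * j)%:R != 0 :> R.
  by rewrite pnatr_eq0 -lt0n addn_gt0 !muln_gt0 a_gt0 b_gt0 /= -addn_gt0.
have Pt : mass (past (update c n true) n.+1) =
    (a * i)%:R / (a * i + b * j)%:R * mass (past c n).
  apply: EFin_inj; rewrite EFinM -!massE // past_update (urnD.2 n c).
  by rewrite /first_count /second_count stE /= -!pmulrn natrD.
have Pf : mass (past c n) = mass (past (update c n true) n.+1) +
    mass (past (update c n false) n.+1).
  have := @mass_split (past c n) setT n (past_meas c n) measurableT.
  by rewrite !setIT -!past_update.
split; first by rewrite Pt mulrA [_ * (_ / _)]mulrC divfK.
apply: (addrI ((a * i + b * j)%:R * mass (past (update c n true) n.+1))).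
by rewrite -mulrDr -Pf Pt mulrA [_ * (_ / _)]mulrC divfK // natrD mulrDl.
Qed.

Let mass0_sub E F : measurable E -> measurable F -> mass E = 0 -> mass (E `&` F) = 0.
Proof.
move=> mE mF E0; apply/eqP; rewrite eq_le mass_ge0 andbT -E0.
have mEF := measurableI _ _ mE mF.
by rewrite -lee_fin -!massE //; apply: le_measure; rewrite ?inE // => w [].
Qed.

(** Conditioning on the next draw gives the recursion that defines [hist].  If a color is
    absent, its draw has probability 0 and coefficient 0, so that the counts never
    leave the multiples of [a] and [b]. *)
Lemma urn_law_from_past (A : int -> bool) k n c i j : (0 < i + j)%N ->
    urn_state a b s a0 b0 c n = ((a * i)%N%:Z, (b * j)%N%:Z) ->
  mass (past c n `&` event A (n + k)) * \prod_(l < k) (a * i + b * j + s * l)%:R =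
  mass (past c n) * hist a b p q (fun i _ => (A (a * i)%N%:Z)%:R) k i j.
Proof.
elim: k n c i j => [|k IHk] n c i j ij stE.
  rewrite big_ord0 mulr1 addn0 /=.
  have XE w : past c n w -> urn_X a b s a0 b0 D n w = (a * i)%N%:Z.
    move=> pw; rewrite /urn_X /first_count (@urn_state_ext _ c) ?stE //.
  case AE: (A _).
    rewrite mulr1; congr mass; apply/seteqP; split => [w []//|w pw]; split => //.
    by rewrite /event /= XE.
  rewrite mulr0; have -> : past c n `&` event A n = set0.
    by apply/seteqP; split => // w [pw]; rewrite /event /= XE ?AE.
  by rewrite /mass measure0.
rewrite (mass_split n (past_meas c n) (event_meas A _)) -!past_update addnS -addSn.
have [mt mf] := mass_draw ij stE.
rewrite big_ord_recl muln0 addn0.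
have prodE (x : nat) : x = (a * i + b * j + s)%N ->
    \prod_(l < k) (a * i + b * j + s * lift ord0 l)%:R =
    \prod_(l < k) (x + s * l)%:R :> R.
  by move=> ->; apply: eq_bigr => l _; rewrite /= /bump add1n mulnS addnA.
rewrite [hist _ _ _ _ _ k.+1 i j]/= mulrDr mulrDl; congr (_ + _).
  case: i ij stE mt mf prodE => [|i] ij stE mt mf prodE.
    have m0 : mass (past (update c n true) n.+1) = 0.
      move: mt; rewrite muln0 mul0r => /eqP; rewrite mulf_eq0 => /orP[|/eqP//].
      by move: ij; rewrite !add0n pnatr_eq0 muln_eq0 !eqn0Ngt b_gt0 => ->.
    have -> : mass (past (update c n true) n.+1 `&` event A (n.+1 + k)) = 0.
      exact: mass0_sub (past_meas _ _) (event_meas _ _) m0.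
    by rewrite muln0 !mul0r mulr0.
  have stE' : urn_state a b s a0 b0 (update c n true) n.+1 =
      ((a * i)%N%:Z, (b * (j + q))%N%:Z).
    by rewrite count_true stE /=; congr (_, _); lia.
  have ijq : (0 < i + (j + q))%N by rewrite !addn_gt0 q_gt0 !orbT.
  have := IHk n.+1 (update c n true) i (j + q)%N ijq stE'.
  rewrite (prodE (a * i + b * (j + q))%N); last by lia.
  move=> IH.
  by rewrite mulrCA IH [LHS]mulrA mt [RHS]mulrA [mass _ * _%:R]mulrC.
case: j ij stE mt mf prodE => [|j] ij stE mt mf prodE.
  have m0 : mass (past (update c n false) n.+1) = 0.
    move: mf; rewrite muln0 mul0r => /eqP; rewrite mulf_eq0 => /orP[|/eqP//].
    by move: ij; rewrite !addn0 pnatr_eq0 muln_eq0 !eqn0Ngt a_gt0 => ->.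
  have -> : mass (past (update c n false) n.+1 `&` event A (n.+1 + k)) = 0.
    exact: mass0_sub (past_meas _ _) (event_meas _ _) m0.
  by rewrite muln0 !mul0r mulr0.
have stE' : st (update c n false) n.+1 = ((a * (i + p))%N%:Z, (b * j)%N%:Z).
  by rewrite count_false stE /=; congr (_, _); lia.
have ipj : (0 < i + p + j)%N by rewrite !addn_gt0 p_gt0 orbT.
have := IHk n.+1 (update c n false) (i + p)%N j ipj stE'.
rewrite (prodE (a * (i + p) + b * j)%N); last by lia.
move=> IH.
by rewrite mulrCA IH [LHS]mulrA mf [RHS]mulrA [mass _ * _%:R]mulrC.
Qed.

Lemma urn_law (A : int -> bool) k i j : (0 < i + j)%N -> a0 = (a * i)%N -> b0 = (b * j)%N ->
  fine (P [set w | A (urn_X a b s a0 b0 D k w)]) * \prod_(l < k) (a0 + b0 + s * l)%:R =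
  hist a b p q (fun i _ => (A (a * i)%N%:Z)%:R) k i j.
Proof.
move=> ij a0E b0E; have := @urn_law_from_past A k 0 (fun=> true) i j ij.
rewrite /= {1}a0E {1}b0E => /(_ erefl).
have -> : past (fun=> true) 0 = setT by apply/seteqP; split.
by rewrite setTI add0n /mass probability_setT /= mul1r -a0E -b0E.
Qed.

End UrnLaw.

(** * Exponential tilting *)

Section GrowthRates.
Variable R : realType.

Lemma growth_rate_cvg (x : nat -> R) (rho : R) : 0 < rho ->
    (forall eta, 0 < eta -> eta < rho -> exists C N, 0 < C /\
       forall n, (N <= n)%N -> C * eta ^+ n <= x n) ->
    (forall eta, rho < eta -> exists2 C, 0 < C & forall n, x n <= C * eta ^+ n) ->
  n%:R^-1 * ln (x n) @[n --> \oo] --> ln rho.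
Proof.
move=> rho0 lower upper; apply/cvgrPdist_le => e e0.
have e2 : 0 < e / 2 by rewrite divr_gt0.
have ex_lt1 : expR (- (e / 2)) < 1 by rewrite expR_lt1 oppr_lt0.
have ex_gt1 : 1 < expR (e / 2) by rewrite expR_gt1.
have [C1 [N1 [C10 C1P]]] : exists C N, 0 < C /\
    forall n, (N <= n)%N -> C * (rho * expR (- (e / 2))) ^+ n <= x n.
  by apply: lower; rewrite ?mulr_gt0 ?expR_gt0 // gtr_pMr.
have [C2 C20 C2P] : exists2 C, 0 < C & forall n, x n <= C * (rho * expR (e / 2)) ^+ n.
  by apply: upper; rewrite ltr_pMr.
pose M := `|ln C1| + `|ln C2|.
near=> n.
have n0 : 0 < n%:R :> R by rewrite ltr0n; near: n; exact: nbhs_infty_gt.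
have nN1 : (N1 <= n)%N by near: n; exact: nbhs_infty_ge.
have nM : M <= n%:R * (e / 2).
  rewrite -ler_pdivrMr //; near: n; exact: nbhs_infty_ger.
have eta1 : 0 < rho * expR (- (e / 2)) by rewrite mulr_gt0 ?expR_gt0.
have eta2 : 0 < rho * expR (e / 2) by rewrite mulr_gt0 ?expR_gt0.
have xl := C1P n nN1; have xu := C2P n.
have xn0 : 0 < x n by apply: lt_le_trans xl; rewrite mulr_gt0 ?exprn_gt0.
have lnl : ln C1 + n%:R * (ln rho - e / 2) <= ln (x n).
  have := xl; rewrite -ler_ln ?posrE ?mulr_gt0 ?exprn_gt0 //.
  rewrite lnM ?posrE ?exprn_gt0 // lnXn // lnM ?posrE ?expR_gt0 // expRK.
  by rewrite mulr_natl.
have lnu : ln (x n) <= ln C2 + n%:R * (ln rho + e / 2).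
  have := xu; rewrite -ler_ln ?posrE ?mulr_gt0 ?exprn_gt0 //.
  rewrite lnM ?posrE ?exprn_gt0 // lnXn // lnM ?posrE ?expR_gt0 // expRK.
  by rewrite mulr_natl.
have M1 : - ln C1 <= M by rewrite (le_trans (ler_norm _)) // normrN lerDl.
have M2 : ln C2 <= M by rewrite (le_trans (ler_norm _)) // lerDr.
rewrite ler_norml; apply/andP; split.
  rewrite lerBrDr -lerBrDl opprK mulrC ler_pdivrMr //; nra.
rewrite lerBlDr -lerBlDl mulrC ler_pdivlMr //; nra.
Unshelve. all: by end_near. Qed.

(** The first factor is at least 1 and the factor of index l >= 1 at least s l. *)
Lemma rising_lower (t0 s n : nat) : (0 < t0)%N -> (0 < n)%N ->
  (s ^ n * n`! <= s * n * \prod_(l < n) (t0 + s * l))%N.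
Proof.
move=> t00; elim: n => [//|[|n] IHn] _.
  by rewrite big_ord_recr big_ord0 /= muln0 addn0 mul1n expn1 !muln1 leq_pmulr.
rewrite big_ord_recr /= expnS factS.
have -> : (s * s ^ n.+1 * (n.+2 * n.+1`!) = s * n.+2 * (s ^ n.+1 * n.+1`!))%N by ring.
rewrite leq_mul2l; apply/orP; right; apply: leq_trans (IHn isT) _.
by rewrite mulnC leq_mul2l leq_addl orbT.
Qed.

Lemma bernoulli_nat (m t : nat) : (m ^ t * (m + t) <= m * m.+1 ^ t)%N.
Proof.
elim: t => [|t IHt]; first by rewrite addn0 !expn0 mul1n muln1.
rewrite !expnS mulnCA; apply: (@leq_trans (m.+1 * (m ^ t * (m + t)))).
  by rewrite mulnAC mulnC [leqRHS]mulnCA leq_mul2l; nia.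
by rewrite leq_mul2l IHt orbT.
Qed.

(** Inductively, t0 + s n <= s (n + 1 + t0), and Bernoulli's inequality turns
    (n + 1 + t0) / (n + 1) into ((n + 2) / (n + 1))^t0. *)
Lemma rising_upper (t0 s n : nat) : (0 < s)%N ->
  (\prod_(l < n) (t0 + s * l) <= s ^ n * n`! * n.+1 ^ t0)%N.
Proof.
move=> s0; elim: n => [|n IHn]; first by rewrite big_ord0 exp1n.
rewrite big_ord_recr /=.
apply: leq_trans (leq_mul IHn (_ : t0 + s * n <= s * (n.+1 + t0)))%N _.
  by nia.
have := bernoulli_nat n.+1 t0; rewrite expnS factS; nia.
Qed.

End GrowthRates.

Section UrnDeviations.
Variables (R : realType) (a b s p q i0 j0 : nat).
Hypotheses (a_gt0 : (0 < a)%N) (b_gt0 : (0 < b)%N) (s_gt0 : (0 < s)%N).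
Hypotheses (apE : (a * p = b + s)%N) (bqE : (b * q = a + s)%N).
Hypothesis init_gt0 : (0 < i0 + j0)%N.

Notation K := (@urn_K R a b s).
Notation h := (urn_h a b s).
Notation hist := (@hist R a b p q).
Notation gap := (@critical_gap R a b s).

Let weight (u : R) (n : nat) : R := hist (mon (u ^+ a) 1) n i0 j0.

Definition below_count (xi : R) (n : nat) : R :=
  hist (fun i _ => ((a * i)%:R <= xi * n%:R)%R%:R) n i0 j0.

Let t0 := (a * i0 + b * j0)%N.

Definition rising n : R := \prod_(l < n) (t0 + s * l)%:R.

Let t0_gt0 : (0 < t0)%N.
Proof. by rewrite addn_gt0 !muln_gt0 a_gt0 b_gt0 /= -addn_gt0. Qed.

Let rising_gt0 n : 0 < rising n.
Proof. by apply: prodr_gt0 => l _; rewrite ltr0n addn_gt0 t0_gt0. Qed.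

Let fact_gt0R n : 0 < n`!%:R :> R. Proof. by rewrite ltr0n fact_gt0. Qed.

Let s0 : 0 < s%:R :> R. Proof. by rewrite ltr0n. Qed.

Let powR_muln (u x : R) n : 0 < u -> u `^ (x * n%:R) = (u `^ x) ^+ n.
Proof. by move=> u0; rewrite powRrM powR_mulrn // powR_ge0. Qed.

(** Markov's inequality for u^X_n. *)
Lemma below_count_le (xi u : R) (n : nat) : 0 < u < 1 ->
  (u `^ xi) ^+ n * below_count xi n <= weight u n.
Proof.
move=> /andP[u0 u1]; rewrite -histZ; apply: ler_hist => i j.
rewrite /mon expr1n mulr1 -exprM -powR_muln //; case: (leP (a * i)%:R (xi * n%:R)) => [le_i|_]; last first.
  by rewrite /= mulr0 exprn_ge0 // ltW.
by rewrite /= mulr1 -powR_mulrn ?(ltW u0) // ger_powR // u0 ltW.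
Qed.

Lemma below_count_upper (xi u eta : R) : 0 < u < 1 ->
    (s%:R * (u `^ xi * K u))^-1 < eta ->
  exists2 C, 0 < C & forall n, below_count xi n / rising n <= C * eta ^+ n.
Proof.
move=> u01 eta_gt; have /andP[u0 u1] := u01.
have K0 := urn_K_gt0 b a_gt0 s_gt0 u01.
have v0 : 0 < u `^ xi by rewrite powR_gt0.
have sv0 : 0 < s%:R * u `^ xi by rewrite mulr_gt0.
have eta0 : 0 < eta.
  by apply: lt_trans eta_gt; rewrite invr_gt0; apply: mulr_gt0 => //; apply: mulr_gt0.
have Ke : (K u)^-1 < eta * (s%:R * u `^ xi).
  by move: eta_gt; rewrite mulrA invfM mulrC ltr_pdivrMr.
pose sigma := ((K u)^-1 + eta * (s%:R * u `^ xi)) / 2.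
have Ks : (K u)^-1 < sigma by rewrite /sigma; lra.
have sig0 : 0 < sigma by apply: lt_trans Ks; rewrite invr_gt0.
have se : sigma / (s%:R * u `^ xi) < eta by rewrite ltr_pdivrMr // /sigma; lra.
clearbody sigma.
have [C C0 CP] := @hist_growth_upper R a b s p q a_gt0 s_gt0 apE bqE u sigma i0 j0 u01 Ks.
have [|B B0 BP] := @polynomial_le_geometric R 1 (sigma / (s%:R * u `^ xi)) eta.
  by rewrite se divr_gt0.
pose C' := Num.max (C * s%:R * B) (below_count xi 0 / rising 0).
exists C' => [|n]; first by rewrite lt_max (mulr_gt0 (mulr_gt0 C0 s0) B0).
case: n => [|n]; first by rewrite expr0 mulr1 le_max lexx orbT.
set m := n.+1.
apply: (@le_trans _ _ (C * s%:R * B * eta ^+ m)); last first.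
  by rewrite ler_wpM2r ?exprn_ge0 ?(ltW eta0) // le_max lexx.
have r0 := rising_gt0 m.
have := BP m; rewrite expr1 => BPm.
have le_r : s%:R ^+ m * m`!%:R <= s%:R * m%:R * rising m.
  rewrite /rising -natr_prod -natrX -!natrM ler_nat; exact: rising_lower.
have le_w := CP m; rewrite ler_pdivrMr // in le_w.
rewrite ler_pdivrMr // -(ler_pM2l (_ : 0 < (u `^ xi) ^+ m)) ?exprn_gt0 //.
apply: le_trans (below_count_le xi m u01) _; apply: le_trans le_w _.
have sm0 : 0 < s%:R ^+ m :> R by rewrite exprn_gt0.
rewrite -(ler_pM2l sm0).
have -> : s%:R ^+ m * (C * sigma ^+ m * m`!%:R) =
    C * sigma ^+ m * (s%:R ^+ m * m`!%:R) by ring.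
apply: (@le_trans _ _ (C * sigma ^+ m * (s%:R * m%:R * rising m))).
  by rewrite ler_wpM2l // mulr_ge0 ?exprn_ge0 // ltW.
have -> : s%:R ^+ m * ((u `^ xi) ^+ m * (C * s%:R * B * eta ^+ m * rising m)) =
   C * s%:R * rising m * (B * eta ^+ m) * (s%:R * u `^ xi) ^+ m by rewrite exprMn; ring.
have -> : C * sigma ^+ m * (s%:R * m%:R * rising m) =
   C * s%:R * rising m * (m%:R * (sigma / (s%:R * u `^ xi)) ^+ m) * (s%:R * u `^ xi) ^+ m.
  rewrite expr_div_n; move: (expf_neq0 m (lt0r_neq0 sv0)).
  move: ((s%:R * u `^ xi) ^+ m) (sigma ^+ m) (m%:R : R) => V S M V0.
  by field; rewrite V0.
rewrite ler_wpM2r ?exprn_ge0 ?(ltW sv0) // ler_wpM2l //.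
by rewrite !mulr_ge0 // ltW.
Qed.

(** Above xi1 n the weight u^X is dominated by that of [u1], suitably normalized, and below
    xi2 n by that of [u2]; in between, u^X is at most u^(xi2 n). *)
Lemma below_count_ge_window (xi1 xi2 u u1 u2 : R) (n : nat) : 0 < u2 -> u2 < u -> u < u1 -> u1 < 1 ->
  weight u n - ((u / u1) `^ xi1) ^+ n * weight u1 n - ((u / u2) `^ xi2) ^+ n * weight u2 n <=
  (u `^ xi2) ^+ n * below_count xi1 n.
Proof.
move=> u20 u2u uu1 u11; have u0 := lt_trans u20 u2u; have u10 := lt_trans u0 uu1.
have u_lt1 := lt_trans uu1 u11.
have -> : weight u n - ((u / u1) `^ xi1) ^+ n * weight u1 n -
    ((u / u2) `^ xi2) ^+ n * weight u2 n =
  hist (fun i j => mon (u ^+ a) 1 i j +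
    (- ((u / u1) `^ xi1) ^+ n) * mon (u1 ^+ a) 1 i j +
    (- ((u / u2) `^ xi2) ^+ n) * mon (u2 ^+ a) 1 i j) n i0 j0.
  by rewrite !histD !histZ !mulNr.
rewrite -histZ; apply: ler_hist => i j; rewrite /mon expr1n !mulr1 -!exprM !mulNr.
rewrite -!powR_muln ?divr_gt0 //.
have splitp (v : R) x : 0 < v ->
    (u / v) `^ x * v ^+ (a * i) = (u / v) `^ x / (u / v) ^+ (a * i) * u ^+ (a * i).
  move=> v0; rewrite expr_div_n; field.
  by rewrite !expf_neq0 // gt_eqF.
have pos1 : 0 <= (u / u1) `^ (xi1 * n%:R) * u1 ^+ (a * i).
  by rewrite mulr_ge0 ?powR_ge0 ?exprn_ge0 // ltW.
have pos2 : 0 <= (u / u2) `^ (xi2 * n%:R) * u2 ^+ (a * i).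
  by rewrite mulr_ge0 ?powR_ge0 ?exprn_ge0 // ltW.
have ui0 : 0 < u ^+ (a * i) by rewrite exprn_gt0.
case: (leP (a * i)%:R (xi1 * n%:R)) => [le1|lt1]; last first.
  rewrite /= mulr0; suff : u ^+ (a * i) <= (u / u1) `^ (xi1 * n%:R) * u1 ^+ (a * i) by lra.
  rewrite splitp // ler_peMl ?(ltW ui0) // ler_pdivlMr ?exprn_gt0 ?divr_gt0 // mul1r.
  rewrite -powR_mulrn; last by rewrite ltW ?divr_gt0.
  rewrite ger_powR //; last exact: ltW.
  by rewrite divr_gt0 //= ler_pdivrMr // mul1r ltW.
rewrite /= mulr1; have [le2|lt2] := leP (xi2 * n%:R) (a * i)%:R.
  suff : u ^+ (a * i) <= u `^ (xi2 * n%:R) by lra.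
  by rewrite -powR_mulrn ?(ltW u0) // ger_powR // u0 ltW.
suff : u ^+ (a * i) <= (u / u2) `^ (xi2 * n%:R) * u2 ^+ (a * i).
  by have := powR_ge0 u (xi2 * n%:R); lra.
rewrite splitp // ler_peMl ?(ltW ui0) // ler_pdivlMr ?exprn_gt0 ?divr_gt0 // mul1r.
rewrite -powR_mulrn; last by rewrite ltW ?divr_gt0.
apply: ler_powR; last exact: ltW.
by rewrite ler_pdivlMr // mul1r ltW.
Qed.

(** The two hypotheses on [K] say that the two subtracted terms of
    [below_count_ge_window] grow at smaller exponential rates than the first one. *)
Lemma below_count_lower (xi1 xi2 u u1 u2 eta : R) :
    0 < u2 -> u2 < u -> u < u1 -> u1 < 1 ->
    u `^ xi1 * K u < u1 `^ xi1 * K u1 -> u `^ xi2 * K u < u2 `^ xi2 * K u2 ->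
    0 < eta -> eta < (s%:R * (u `^ xi2 * K u))^-1 ->
  exists C N, 0 < C /\
    forall n, (N <= n)%N -> C * eta ^+ n <= below_count xi1 n / rising n.
Proof.
move=> u20 u2u uu1 u11 lt_K1 lt_K2 eta0 eta_lt.
have u0 := lt_trans u20 u2u; have u10 := lt_trans u0 uu1; have u_lt1 := lt_trans uu1 u11.
have u01 : 0 < u < 1 by rewrite u0.
have u1_01 : 0 < u1 < 1 by rewrite u10.
have u2_01 : 0 < u2 < 1 by rewrite u20 (lt_trans u2u).
have K0 := urn_K_gt0 b a_gt0 s_gt0 u01.
have K10 := urn_K_gt0 b a_gt0 s_gt0 u1_01.
have K20 := urn_K_gt0 b a_gt0 s_gt0 u2_01.
have v0 : 0 < u `^ xi2 by rewrite powR_gt0.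
have sv0 : 0 < s%:R * u `^ xi2 by rewrite mulr_gt0.
(* room between the normalized rate of a side term and the rate of the main term *)
have side (v xi : R) : 0 < v -> 0 < K v -> u `^ xi * K u < v `^ xi * K v ->
    exists2 tau, (K v)^-1 < tau & (u / v) `^ xi * tau < (K u)^-1.
  move=> v_gt0 Kv0 lt_Kv.
  have uv0 : 0 < (u / v) `^ xi by rewrite powR_gt0 // divr_gt0.
  have vE : (u / v) `^ xi = u `^ xi / v `^ xi.
    by rewrite powRM ?invr_ge0 ?(ltW u0) ?(ltW v_gt0) // -(powR_inv1 (ltW v_gt0)) -powRrM mulN1r powRN.
  have wK : K u * (u / v) `^ xi < K v.
    by rewrite vE mulrA ltr_pdivrMr ?powR_gt0 // mulrC [ltRHS]mulrC.
  have lt_v : (K v)^-1 < (K u)^-1 / (u / v) `^ xi.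
    by rewrite -invfM ltf_pV2 // posrE; exact: mulr_gt0.
  exists (((K v)^-1 + (K u)^-1 / (u / v) `^ xi) / 2); first by lra.
  by rewrite mulrC -ltr_pdivlMr //; lra.
have [tau1 tau1K lt1] := side u1 xi1 u10 K10 lt_K1.
have [tau2 tau2K lt2] := side u2 xi2 u20 K20 lt_K2.
have tau10 : 0 < tau1 by apply: lt_trans tau1K; rewrite invr_gt0.
have tau20 : 0 < tau2 by apply: lt_trans tau2K; rewrite invr_gt0.
set r1 := (u / u1) `^ xi1 * tau1 in lt1; set r2 := (u / u2) `^ xi2 * tau2 in lt2.
have lt_eta : eta * (s%:R * u `^ xi2) < (K u)^-1.
  by rewrite -ltr_pdivlMr // mulrC -invfM -mulrA.
have Ki0 : 0 < (K u)^-1 by rewrite invr_gt0.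
pose lo := Num.max (eta * (s%:R * u `^ xi2)) (Num.max r1 r2).
have lo_lt : lo < (K u)^-1 by rewrite !gt_max lt_eta lt1 lt2.
pose sigma := (lo + (K u)^-1) / 2.
have lo_s : lo < sigma by rewrite /sigma; lra.
have s_K : sigma < (K u)^-1 by rewrite /sigma; lra.
clearbody sigma.
have lo_eta : eta * (s%:R * u `^ xi2) <= lo by rewrite le_max lexx.
have lo_r1 : r1 <= lo by rewrite !le_max lexx orbT.
have lo_r2 : r2 <= lo by rewrite !le_max lexx !orbT.
have lo0 : 0 < lo by apply: lt_le_trans lo_eta; rewrite mulr_gt0.
clearbody lo.
have sig0 := lt_trans lo0 lo_s.
have [C C0 CP] := @hist_growth_lower R a b s p q a_gt0 b_gt0 s_gt0 apE bqE u sigma i0 j0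
  init_gt0 u01 sig0 s_K.
have [C1 C10 C1P] := @hist_growth_upper R a b s p q a_gt0 s_gt0 apE bqE u1 tau1 i0 j0 u1_01 tau1K.
have [C2 C20 C2P] := @hist_growth_upper R a b s p q a_gt0 s_gt0 apE bqE u2 tau2 i0 j0 u2_01 tau2K.
have [|B B0 BP] := @polynomial_le_geometric R t0 (eta * (s%:R * u `^ xi2)) sigma.
  by rewrite mulr_gt0 //= (le_lt_trans lo_eta).
have k1 : `|lo / sigma| < 1.
  by rewrite ger0_norm ?divr_ge0 ?ltW // ltr_pdivrMr // mul1r.
have C120 : 0 < C1 + C2 by rewrite addr_gt0.
have eps0 : 0 < C / 2 / (C1 + C2) by rewrite !divr_gt0.
have /cvgr_norm_lt /(_ _) : (fun n => (lo / sigma) ^+ n) @ \oo --> (0 : R).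
  exact: cvg_expr.
move=> /(_ (C / 2 / (C1 + C2))); case=> [|N _ NP]; first by rewrite normr0.
pose x := eta * (s%:R * u `^ xi2); have x0 : 0 < x by rewrite mulr_gt0.
exists (C / 2 * x / (B * sigma)), N; split.
  by rewrite divr_gt0 ?mulr_gt0 // divr_gt0.
move=> n Nn; have f0 := fact_gt0R n.
have le_w := below_count_ge_window xi1 xi2 n u20 u2u uu1 u11.
have w0 := CP n; rewrite ler_pdivlMr // in w0.
have w1 : ((u / u1) `^ xi1) ^+ n * weight u1 n <= C1 * lo ^+ n * n`!%:R.
  have := C1P n; rewrite ler_pdivrMr // => le1.
  apply: (@le_trans _ _ (C1 * r1 ^+ n * n`!%:R)).
    have -> : C1 * r1 ^+ n * n`!%:R = ((u / u1) `^ xi1) ^+ n * (C1 * tau1 ^+ n * n`!%:R).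
      by rewrite /r1 exprMn; ring.
    by rewrite ler_wpM2l ?exprn_ge0 ?powR_ge0.
  rewrite ler_wpM2r // ler_wpM2l ?(ltW C10) // lerXn2r // nnegrE ?(ltW lo0) //.
  by rewrite mulr_ge0 ?powR_ge0 // ltW.
have w2 : ((u / u2) `^ xi2) ^+ n * weight u2 n <= C2 * lo ^+ n * n`!%:R.
  have := C2P n; rewrite ler_pdivrMr // => le2.
  apply: (@le_trans _ _ (C2 * r2 ^+ n * n`!%:R)).
    have -> : C2 * r2 ^+ n * n`!%:R = ((u / u2) `^ xi2) ^+ n * (C2 * tau2 ^+ n * n`!%:R).
      by rewrite /r2 exprMn; ring.
    by rewrite ler_wpM2l ?exprn_ge0 ?powR_ge0.
  rewrite ler_wpM2r // ler_wpM2l ?(ltW C20) // lerXn2r // nnegrE ?(ltW lo0) //.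
  by rewrite mulr_ge0 ?powR_ge0 // ltW.
have lo_n : (C1 + C2) * lo ^+ n <= C / 2 * sigma ^+ n.
  have k0 : 0 <= lo / sigma by rewrite divr_ge0 // ltW.
  have /ltW := NP n Nn; rewrite ger0_norm ?exprn_ge0 //.
  by rewrite expr_div_n ler_pdivrMr ?exprn_gt0 // mulrAC ler_pdivlMr // mulrC.
have main : C / 2 * sigma ^+ n * n`!%:R <= (u `^ xi2) ^+ n * below_count xi1 n.
  apply: le_trans le_w.
  have := ler_wpM2r (ltW f0) lo_n; rewrite mulrDl mulrDl.
  move: w0; rewrite -/(weight u n); move: (weight u n) w1 w2 => W0 w1 w2 w0.
  have -> : C / 2 * sigma ^+ n * n`!%:R = C * sigma ^+ n * n`!%:R / 2 by ring.
  by lra.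
have le_r : rising n <= s%:R ^+ n * n`!%:R * n.+1%:R ^+ t0.
  rewrite /rising -natr_prod -!natrX -!natrM ler_nat; exact: rising_upper.
have r0 := rising_gt0 n.
rewrite ler_pdivlMr // -(ler_pM2l (exprn_gt0 n v0)); apply: le_trans main.
have Bs0 : 0 < B * sigma by rewrite mulr_gt0.
have pre0 : 0 < C / 2 * x / (B * sigma) by rewrite divr_gt0 ?mulr_gt0 // divr_gt0.
apply: (@le_trans _ _ ((u `^ xi2) ^+ n * (C / 2 * x / (B * sigma) * eta ^+ n *
    (s%:R ^+ n * n`!%:R * n.+1%:R ^+ t0)))).
  by rewrite ler_wpM2l ?exprn_ge0 ?(ltW v0) // ler_wpM2l // mulr_ge0 ?exprn_ge0 // ltW.
have BPn := BP n.+1; rewrite -/x in BPn.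
have -> : (u `^ xi2) ^+ n * (C / 2 * x / (B * sigma) * eta ^+ n *
    (s%:R ^+ n * n`!%:R * n.+1%:R ^+ t0)) =
  C / 2 * n`!%:R * ((n.+1%:R ^+ t0 * x ^+ n.+1) / (B * sigma)).
  by rewrite exprS [x ^+ n]exprMn exprMn; ring.
rewrite [leRHS]mulrAC ler_wpM2l //; first by rewrite mulr_ge0 // divr_ge0 // ltW.
by rewrite ler_pdivrMr //; apply: le_trans BPn _; rewrite exprSr mulrCA.
Qed.

End UrnDeviations.

(** * The rate function *)

Section RateFunction.
Variables (R : realType) (a b s : nat).
Hypotheses (a_gt0 : (0 < a)%N) (b_gt0 : (0 < b)%N) (s_gt0 : (0 < s)%N).

Notation K := (@urn_K R a b s).
Notation h := (urn_h a b s).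
Notation gap := (@critical_gap R a b s).

Let s0 : 0 < s%:R :> R. Proof. by rewrite ltr0n. Qed.

(** With [critical_gap_root], this makes the optimal parameter an increasing function
    of [xi]. *)
Lemma critical_gap_mono (xi xi' u : R) : 0 < xi -> xi < xi' -> xi' < s%:R -> 0 < u < 1 ->
  gap xi u < gap xi' u.
Proof.
move=> xi0 xixi xis u01; have /andP[u0 u1] := u01.
have /andP[U0 U1] : 0 < u ^+ h < 1 by apply: unit_expn u01; rewrite /urn_h !addn_gt0 a_gt0.
have xis' := lt_trans xixi xis.
have B0 := critical_denom_gt0 b a_gt0 xi0 xis' u01.
have B0' := critical_denom_gt0 b a_gt0 (lt_trans xi0 xixi) xis u01.
rewrite /critical_gap ltrD2l ltrN2 ltr_pM2l; last first.
  by rewrite mulr_gt0 ?exprn_gt0 // delta_gt0.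
rewrite ltf_pV2 ?posrE // /critical_denom.
have : 0 < (xi' - xi) * (1 - u ^+ h) by rewrite mulr_gt0 ?subr_gt0.
by move: (u ^+ h) => U; lra.
Qed.

Lemma mean_lt_s (xi : R) : xi < s%:R * ((s + b)%:R / (s + h)%:R) -> xi < s%:R.
Proof.
move=> /lt_trans; apply; rewrite gtr_pMr // ltr_pdivrMr ?ltr0n ?addn_gt0 ?s_gt0 //.
by rewrite mul1r ltr_nat /urn_h; lia.
Qed.

Lemma rate_objectiveE (xi l : R) : rate_objective a b s xi l = ln (s%:R * (l `^ xi * K l)).
Proof. by rewrite /rate_objective mulrA. Qed.

Lemma rate_base_gt0 (xi l : R) : 0 < l < 1 -> 0 < s%:R * (l `^ xi * K l).
Proof.
move=> l01; have /andP[l0 _] := l01; apply: mulr_gt0 => //.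
by apply: mulr_gt0; [rewrite powR_gt0 | apply: urn_K_gt0].
Qed.

(** A maximum of u^xi K(u) is a maximum of the objective, hence equal to its supremum. *)
Lemma rate_function_max (xi l : R) : 0 < l < 1 ->
    (forall u, 0 < u < 1 -> u != l -> u `^ xi * K u < l `^ xi * K l) ->
  (forall u, 0 < u < 1 -> rate_objective a b s xi u <= rate_objective a b s xi l) /\
  rate_function a b s xi = rate_objective a b s xi l.
Proof.
move=> l01 l_max.
have le_l u : 0 < u < 1 -> rate_objective a b s xi u <= rate_objective a b s xi l.
  move=> u01; rewrite !rate_objectiveE ler_ln ?posrE ?rate_base_gt0 // ler_pM2l //.
  by have [->|ul] := eqVneq u l; [|exact/ltW/l_max].
split=> //; apply/eqP; rewrite eq_le; apply/andP; split.
  apply: ge_sup; first by exists (rate_objective a b s xi l), l => //=; rewrite in_itv.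
  by move=> _ [u + <-]; rewrite /= in_itv => /le_l.
apply: ub_le_sup; last by exists l => //=; rewrite in_itv.
by exists (rate_objective a b s xi l) => _ [u + <-]; rewrite /= in_itv => /le_l.
Qed.

Lemma critical_pointE (xi l : R) : 0 < xi -> xi < s%:R ->
  critical_point a b s xi l <-> 0 < l < 1 /\ gap xi l = 0.
Proof.
move=> xi0 xis.
have pref u : 0 < u < 1 -> critical_denom a b s xi u /
    (urn_delta a b s u ^+ s * urn_delta a b s u ^+ h * K u) != 0.
  move=> u01; rewrite gt_eqF // divr_gt0 ?critical_denom_gt0 //.
  by apply: mulr_gt0; [rewrite mulr_gt0 ?exprn_gt0 ?delta_gt0 | apply: urn_K_gt0].
split=> [[l01 _]|[l01 g0]].
  rewrite urn_K_log_derive // mulrAC => /eqP; rewrite mulf_eq0 (negPf (pref _ l01)) /=.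
  by move/eqP.
split=> //; first exact: (@ex_derive _ _ _ _ _ _ _ (urn_K_derive b a_gt0 s_gt0 l01)).
by rewrite urn_K_log_derive // g0 mulr0 mul0r.
Qed.

(** As [xi2] tends to [xi] from below, its optimal parameter [u2] stays above that of
    xi / 2, so that u^(xi2 - xi) tends to 1 for [u] between [u2] and [l]; hence every
    growth rate below the optimal one is exceeded for some [xi2]. *)
Lemma deviation_window (xi l eta : R) : 0 < xi ->
    xi < s%:R * ((s + b)%:R / (s + h)%:R) ->
    0 < l < 1 -> gap xi l = 0 -> (forall u, l < u < 1 -> gap xi u < 0) ->
    (forall u, 0 < u < l -> 0 < gap xi u) ->
    0 < eta -> eta < (s%:R * (l `^ xi * K l))^-1 ->
  exists xi2 u u2 : R, [/\ 0 < u2, u2 < u, u < l,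
    u `^ xi2 * K u < u2 `^ xi2 * K u2 & eta < (s%:R * (u `^ xi2 * K u))^-1].
Proof.
move=> xi0 xi_lt l01 gl neg pos eta0 eta_lt; have xis := mean_lt_s xi_lt.
have /andP[l0 l1] := l01.
have El0 := rate_base_gt0 xi l01.
have q0 : 0 < eta * (s%:R * (l `^ xi * K l)) by exact: mulr_gt0.
have q1 : eta * (s%:R * (l `^ xi * K l)) < 1 by rewrite -ltr_pdivlMr // mul1r.
have hxi0 : 0 < xi / 2 by rewrite divr_gt0.
have hxi_lt : xi / 2 < s%:R * ((s + b)%:R / (s + h)%:R) by apply: lt_trans xi_lt; lra.
have [mu [mu01 _ mu_pos _]] := critical_gap_root a_gt0 b_gt0 s_gt0 hxi0 hxi_lt.
have /andP[mu0 mu1] := mu01.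
pose L := - ln (eta * (s%:R * (l `^ xi * K l))); pose B := - ln mu.
have L0 : 0 < L by rewrite oppr_gt0 ln_lt0 // q0.
have B0 : 0 < B by rewrite oppr_gt0 ln_lt0.
(* small enough for mu ^ eps to exceed the quotient of eta by the optimal rate *)
pose eps := Num.min (xi / 2) (L / (2 * B)).
have eps0 : 0 < eps by rewrite lt_min hxi0 divr_gt0 // mulr_gt0.
have eps1 : eps <= xi / 2 by rewrite ge_min lexx.
have eps2 : eps <= L / (2 * B) by rewrite ge_min lexx orbT.
pose xi2 := xi - eps.
have xi2_0 : 0 < xi2 by rewrite /xi2; lra.
have xi2_xi : xi2 < xi by rewrite /xi2; lra.
have xi2_s : xi2 < s%:R by apply: lt_trans xis.
have [u2 [u2_01 g2 pos2 neg2]] := critical_gap_root a_gt0 b_gt0 s_gt0 xi2_0 (lt_trans xi2_xi xi_lt).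
have /andP[u20 u21] := u2_01.
have u2l : u2 < l.
  rewrite ltNge; apply/negP => lu2; have := critical_gap_mono xi2_0 xi2_xi xis l01.
  rewrite gl; apply/negP; rewrite -leNgt.
  move: lu2; rewrite le_eqVlt => /predU1P[->|lu2]; first by rewrite g2.
  by apply/ltW/pos2; rewrite l0.
have mu_u2 : mu <= u2.
  rewrite leNgt; apply/negP => u2mu.
  have : 0 < gap (xi / 2) u2 by apply: mu_pos; rewrite u20.
  apply/negP; rewrite -leNgt -g2.
  have [->//|ne] := eqVneq (xi / 2) xi2.
  by apply/ltW/critical_gap_mono => //; rewrite lt_neqAle ne /xi2; lra.
pose u := (u2 + l) / 2.
have u2u : u2 < u by rewrite /u; lra.
have ul : u < l by rewrite /u; lra.
clearbody u; have u0 := lt_trans u20 u2u.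
have u01 : 0 < u < 1 by rewrite u0 (lt_trans ul).
exists xi2, u, u2; split=> //.
  by apply: (rate_base_lt a_gt0 s_gt0 xi2_0 xi2_s u2_01 pos2 neg2 u01); rewrite gt_eqF.
have Eu : u `^ xi * K u < l `^ xi * K l.
  by apply: (rate_base_lt a_gt0 s_gt0 xi0 xis l01 pos neg u01); rewrite lt_eqF.
have ue0 : 0 < u `^ eps by rewrite powR_gt0.
have Eu2 := rate_base_gt0 xi2 u01.
rewrite -[ltRHS]mul1r ltr_pdivlMr // -(ltr_pM2r ue0) mul1r.
have -> : eta * (s%:R * (u `^ xi2 * K u)) * u `^ eps = eta * (s%:R * (u `^ xi * K u)).
  have -> : u `^ xi = u `^ xi2 * u `^ eps.
    by rewrite -powRD ?subrK // (gt_eqF u0) implybT.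
  by ring.
apply: (@lt_le_trans _ _ (eta * (s%:R * (l `^ xi * K l)))).
  by rewrite ltr_pM2l // ltr_pM2l.
apply: (@le_trans _ _ (mu `^ eps)).
  rewrite -ler_ln ?posrE ?powR_gt0 // ln_powR -[leLHS]opprK -/L.
  rewrite -[ln mu]opprK -/B mulrN lerN2.
  apply: le_trans (ler_wpM2r (ltW B0) eps2) _.
  have -> : L / (2 * B) * B = L / 2 by field; rewrite gt_eqF.
  by lra.
by rewrite ge0_ler_powR ?nnegrE ?ltW // (le_lt_trans mu_u2).
Qed.

End RateFunction.

Theorem corollary4 (R : realType) (d : measure_display) (T : measurableType d)
    (P : probability T R) (a b s a0 b0 : nat) (D : nat -> T -> bool) (xi : R)
    (a_gt0 : (0 < a)%N) (b_gt0 : (0 < b)%N) (s_gt0 : (0 < s)%N)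
    (init_gt0 : (1 <= a0 + b0)%N)
    (tenable_a0 : (a %| a0)%N) (tenable_b0 : (b %| b0)%N)
    (tenable_a : (a %| b + s)%N) (tenable_b : (b %| a + s)%N)
    (urnD : urn_draws P a b s a0 b0 D)
    (xi_gt0 : 0 < xi)
    (xi_lt : xi < s%:R * ((s + b)%:R / (s + urn_h a b s)%:R)) :
  [/\
      (exists2 lambda : R, 0 < lambda < 1 &
         rate_function a b s xi = rate_objective a b s xi lambda) /\
      (forall lambda : R, 0 < lambda < 1 ->
         rate_objective a b s xi lambda <= rate_function a b s xi),
      n%:R^-1 * ln (fine (P [set w | (urn_X a b s a0 b0 D n w)%:~R <= xi * n%:R]))
        @[n --> \oo] --> - rate_function a b s xi,
      (exists lambda0 : R, critical_point a b s xi lambda0) &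
      forall lambda0 : R, critical_point a b s xi lambda0 ->
        rate_function a b s xi = rate_objective a b s xi lambda0].
Proof.
have xis := mean_lt_s a_gt0 b_gt0 s_gt0 xi_lt.
have [l [l01 gl pos neg]] := critical_gap_root a_gt0 b_gt0 s_gt0 xi_gt0 xi_lt.
have /andP[l0 l1] := l01.
have [le_l rateE] := rate_function_max a_gt0 s_gt0 l01
  (fun u => @rate_base_lt R a b s a_gt0 s_gt0 xi l u xi_gt0 xis l01 pos neg).
have critE l' := @critical_pointE R a b s a_gt0 s_gt0 xi l' xi_gt0 xis.
split.
- by split; [exists l | move=> u u01; rewrite rateE le_l].
- rewrite rateE rate_objectiveE -lnV ?posrE ?rate_base_gt0 //.
  pose p := ((b + s) %/ a)%N; pose q := ((a + s) %/ b)%N.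
  have apE : (a * p = b + s)%N by rewrite mulnC divnK.
  have bqE : (b * q = a + s)%N by rewrite mulnC divnK.
  have p_gt0 : (0 < p)%N by rewrite divn_gt0 // dvdn_leq // addn_gt0 b_gt0.
  have q_gt0 : (0 < q)%N by rewrite divn_gt0 // dvdn_leq // addn_gt0 a_gt0.
  pose i0 := (a0 %/ a)%N; pose j0 := (b0 %/ b)%N.
  have a0E : a0 = (a * i0)%N by rewrite mulnC divnK.
  have b0E : b0 = (b * j0)%N by rewrite mulnC divnK.
  have ij0 : (0 < i0 + j0)%N.
    by move: init_gt0; rewrite {1}a0E {1}b0E !addn_gt0 !muln_gt0 a_gt0 b_gt0.
  have r0 n : 0 < rising R a b s i0 j0 n.
    by apply: prodr_gt0 => k _; rewrite ltr0n addn_gt0 -a0E -b0E init_gt0.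
  have lawE n : fine (P [set w | (urn_X a b s a0 b0 D n w)%:~R <= xi * n%:R]) =
      below_count a b p q i0 j0 xi n / rising R a b s i0 j0 n.
    apply: (canRL (mulfK (lt0r_neq0 (r0 n)))).
    have := urn_law a_gt0 b_gt0 p_gt0 q_gt0 apE bqE urnD
      (fun z : int => (z%:~R <= xi * n%:R)%R) n ij0 a0E b0E.
    rewrite /rising -a0E -b0E => ->.
    by rewrite /below_count; congr hist; apply/funext => i; apply/funext => j; rewrite -pmulrn.
  apply: growth_rate_cvg; first by rewrite invr_gt0 rate_base_gt0.
  + move=> eta eta0 eta_lt.
    have [xi2 [u [u2 [u20 u2u ul lt_u eta_u]]]] :=
      deviation_window a_gt0 b_gt0 s_gt0 xi_gt0 xi_lt l01 gl neg pos eta0 eta_lt.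
    have u0 := lt_trans u20 u2u; have u01 : 0 < u < 1 by rewrite u0 (lt_trans ul).
    have lt_l : u `^ xi * urn_K a b s u < l `^ xi * urn_K a b s l.
      by apply: (rate_base_lt a_gt0 s_gt0 xi_gt0 xis l01 pos neg u01); rewrite lt_eqF.
    have [C [N [C0 CP]]] := below_count_lower a_gt0 b_gt0 s_gt0 apE bqE ij0 u20 u2u ul l1
      lt_l lt_u eta0 eta_u.
    by exists C, N; split=> // n /CP; rewrite lawE.
  + move=> eta eta_gt.
    have [C C0 CP] := below_count_upper a_gt0 b_gt0 s_gt0 apE bqE ij0 l01 eta_gt.
    by exists C => // n; rewrite lawE.
- by exists l; apply/critE.
- move=> l' /critE [l'01 gl']; rewrite rateE; congr rate_objective.
  have [lt_l|lt_l|//] := ltgtP l l'.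
    by have := neg l'; rewrite lt_l gl' ltxx; case/andP: l'01 => _ -> /(_ isT).
  by have := pos l'; rewrite lt_l gl' ltxx; case/andP: l'01 => -> _ /(_ isT).
Qed.
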